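(* Let $n\ge 1$ and $1\le j\le n$ be integers, let $K,L\in\mathcal{K}^n_o$ and let $\varepsilon>0$. Then $$\Phi_{n-j}(K+\varepsilon\cdot L)^{1/j}\ \geq\ \Phi_{n-j}(K)^{1/j}+\varepsilon\,\Phi_{n-j}(L)^{1/j}.$$
   Context: A convex body in $\mathbb{R}^n$ is a compact convex set with nonempty interior; $\mathcal{K}^n_o$ denotes the set of convex bodies in $\mathbb{R}^n$ containing the origin in their interiors. $K+\varepsilon\cdot L=\{x+\varepsilon y: x\in K,\ y\in L\}$ is the Minkowski combination. $G_{n,j}$ is the Grassmann manifold of $j$-dimensional linear subspaces of $\mathbb{R}^n$ and $\mu_j$ is the normalized (total mass $1$) rotation-invariant Haar measure on $G_{n,j}$. $\omega_j$ is the volume of the $j$-dimensional unit ball. For a convex body $K$ and $\xi\in G_{n,j}$, $K|\xi$ is the orthogonal projection of $K$ onto $\xi$ and $\mathrm{vol}_j(K|\xi)$ is its $j$-dimensional volume. The affine quermassintegral is $$\Phi_{n-j}(K):=\omega_n\left[\int_{G_{n,j}}\left(\frac{\mathrm{vol}_j(K|\xi)}{\omega_j}\right)^{-n}d\mu_j(\xi)\right]^{-1/n},$$ so that for $j=n$ it equals the volume $V(K)$. *)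

(* Defs.v *)
From HB Require Import structures.
From mathcomp Require Import all_boot all_order all_algebra.
From mathcomp Require Import all_classical all_reals all_analysis.

Set Implicit Arguments.
Unset Strict Implicit.
Unset Printing Implicit Defensive.
Import Order.TTheory GRing.Theory Num.Theory.
Import numFieldNormedType.Exports.

Local Open Scope classical_set_scope.
Local Open Scope ring_scope.

Section ConvexBodies.
Context {R : realType} {n : nat}.
Implicit Types K L : set 'rV[R]_n.

Definition convex_body K : Prop :=
  [/\ compact K, convex_set K & K° !=set0].

Definition convex_body_o K : Prop := convex_body K /\ K° 0.

Definition minkowski_comb K (eps : R) L : set 'rV[R]_n :=
  [set z | exists x y, [/\ K x, L y & z = x + eps *: y]].

End ConvexBodies.

(* Lebesgue measure on R^n as the n-fold product of the Lebesgue measure on R,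
   evaluated on sets of row vectors through their coordinate tuples. *)
Fixpoint lebesgue_tuple (R : realType) (n : nat) : set (n.-tuple R) -> \bar R :=
  if n is m.+1 then fun A =>
    (@lebesgue_measure R \x lebesgue_tuple (n := m))%E
      [set p : R * m.-tuple R | A [tuple of p.1 :: p.2]]
  else \d_[tuple].

Definition lebesgue_rV (R : realType) (n : nat) (A : set 'rV[R]_n) : \bar R :=
  lebesgue_tuple [set t : n.-tuple R | A (\row_i tnth t i)].

(* The library norm on 'rV[R]_n is the sup norm, hence the explicit Euclidean
   ball. *)
Definition omega (R : realType) (n : nat) : R :=
  fine (lebesgue_rV [set x : 'rV[R]_n | \sum_i x 0 i ^+ 2 <= 1]).

Section OrthogonalProjection.
Context {R : realType} {n : nat}.
Implicit Types (V : {vspace 'rV[R]_n}) (x y : 'rV[R]_n).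

Definition basis_mx V : 'M[R]_(\dim V, n) := \matrix_i (vbasis V)`_i.

Definition orthv V : {vspace 'rV[R]_n} :=
  lker (linfun (mulmxr (basis_mx V)^T : 'rV[R]_n -> 'rV[R]_(\dim V))).

Definition oproj V : 'End('rV[R]_n) := daddv_pi V (orthv V).

Lemma mem_orthv V x :
  reflect (forall y, y \in V -> x *m y^T = 0) (x \in orthv V).
Proof.
rewrite memv_ker lfunE /=; apply: (iffP eqP) => [xV y yV|xV].
  have -> : y = (\row_i coord (vbasis V) i y) *m basis_mx V.
    rewrite mulmx_sum_row [LHS](coord_vbasis yV).
    by apply: eq_bigr => i _; rewrite mxE rowK.
  by rewrite trmx_mul mulmxA xV mul0mx.
apply/rowP => i; rewrite [RHS]mxE.
have /xV/matrixP/(_ 0 0) : (vbasis V)`_i \in V.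
  by rewrite vbasis_mem// mem_nth// size_tuple.
rewrite [RHS]mxE => <-; rewrite !mxE.
by apply: eq_bigr => k _; rewrite !mxE.
Qed.

Lemma dot_eq0 x : x *m x^T = 0 -> x = 0.
Proof.
move=> /matrixP/(_ 0 0); rewrite !mxE => xx.
apply/rowP => i; rewrite mxE; apply/eqP.
rewrite -[_ == 0]orbb -mulf_eq0; apply/eqP.
have x2 k : true -> 0 <= x 0 k * x^T k 0 by rewrite mxE -expr2 sqr_ge0.
by have := psumr_eq0P x2 xx (i := i) isT; rewrite mxE.
Qed.

Lemma capv_orthv V : (V :&: orthv V)%VS = 0%VS.
Proof.
apply/eqP; rewrite -subv0; apply/subvP => x /memv_capP[xV /mem_orthv xo].
by rewrite memv0; apply/eqP/dot_eq0/xo.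
Qed.

Lemma addv_orthv V : (V + orthv V)%VS = fullv.
Proof.
apply/eqP; rewrite eqEdim subvf/= dimv_disjoint_sum ?capv_orthv//.
have := limg_ker_dim
  (linfun (mulmxr (basis_mx V)^T : 'rV[R]_n -> 'rV[R]_(\dim V))) fullv.
rewrite capfv => <-; rewrite -[X in (X <= _)%N]addnC leq_add2r.
by apply: (leq_trans (dimvS (subvf _))); rewrite dimvf /dim/= mul1n.
Qed.

Lemma oprojP V x : oproj V x \in V /\ x - oproj V x \in orthv V.
Proof.
split; first exact: memv_pi.
have xf : x \in (V + orthv V)%VS by rewrite addv_orthv memvf.
rewrite /oproj -{1}(daddv_pi_add (capv_orthv V) xf) addrC addKr.
exact: memv_pi.
Qed.

End OrthogonalProjection.

Section Grassmannian.
Context {R : realType} {n j : nat}.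

(* The proof of j <= n makes the type inhabited, which the library requires of
   every measurable space. *)
Definition grassmannian (jn : (j <= n)%N) : Type :=
  {V : {vspace 'rV[R]_n} | \dim V == j}.

Lemma grassmannian_inhabited (jn : (j <= n)%N) :
  exists V : {vspace 'rV[R]_n}, \dim V == j.
Proof.
exists <<take j (vbasis fullv)>>%VS; apply/eqP.
have /basis_free : basis_of fullv (vbasis (@fullv _ 'rV[R]_n)) := vbasisP _.
rewrite -{1}(cat_take_drop j (vbasis fullv)) => /catl_free/eqP ->.
by rewrite size_takel// size_tuple dimvf /dim/= mul1n.
Qed.

Context (jn : (j <= n)%N).
Implicit Types xi : grassmannian jn.

HB.instance Definition _ := Choice.on (grassmannian jn).
HB.instance Definition _ := isPointed.Build (grassmannian jn)
  (Sub _ (xchooseP (grassmannian_inhabited jn))).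

Definition gspace xi : {vspace 'rV[R]_n} := val xi.

(* The topology of G_{n,j}: the one that makes the identification of a subspace
   with the matrix of its orthogonal projection a homeomorphism. *)
Definition gproj_mx xi : 'M[R]_n := lin1_mx (oproj (gspace xi)).
HB.instance Definition _ :=
  Topological.copy (grassmannian jn) (initial_topology gproj_mx).

Definition borel_grassmannian := g_sigma_algebraType (@open (grassmannian jn)).

Definition rotation (Q : 'M[R]_n) : Prop := Q *m Q^T = 1%:M /\ \det Q = 1.

Definition rotate (Q : 'M[R]_n) (A : set (grassmannian jn)) :
    set (grassmannian jn) :=
  [set xi | exists2 eta, A eta &
     gspace xi = (linfun (mulmxr Q : 'rV[R]_n -> 'rV[R]_n) @: gspace eta)%VS].

Definition haar (mu : probability borel_grassmannian R) : Prop :=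
  forall (Q : 'M[R]_n) (A : set borel_grassmannian),
    rotation Q -> measurable A -> mu (rotate Q A) = mu A.

Definition orthonormal_basis xi : set 'M[R]_(j, n) :=
  [set U | U *m U^T = 1%:M /\ forall i, row i U \in gspace xi].

(* vol_j on xi, read off in the coordinates of some orthonormal basis of xi *)
Definition gvol xi (A : set 'rV[R]_n) : R :=
  fine (lebesgue_rV [set c : 'rV[R]_j | A (c *m get (orthonormal_basis xi))]).

Definition projection (K : set 'rV[R]_n) xi : set 'rV[R]_n :=
  oproj (gspace xi) @` K.

(* [affine_quermass mu K] is Phi_{n-j}(K). *)
Definition affine_quermass (mu : probability borel_grassmannian R)
    (K : set 'rV[R]_n) : R :=
  omega R n *
  (\int[mu]_xi (gvol xi (projection K xi) / omega R j) ^- n) `^ (- n%:R^-1).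

End Grassmannian.

Lemma orthonormal_mx_exists (R : realType) (n j : nat) (V : {vspace 'rV[R]_n}) :
  \dim V = j ->
  exists U : 'M[R]_(j, n), U *m U^T = 1%:M /\ forall i, row i U \in V.
Proof.
elim: j V => [|j IH] V dV.
  by exists 0; split=> [|[]//]; apply/matrixP => -[].
pose v := vpick V.
have v0 : v != 0 by rewrite vpick0 -dimv_eq0 dV.
have vv : 0 < (v *m v^T) 0 0.
  rewrite lt_neqAle eq_sym; apply/andP; split.
    apply: contra v0 => /eqP vv0; apply/eqP/dot_eq0/matrixP => a b.
    by rewrite !ord1 vv0 mxE.
  by rewrite mxE sumr_ge0// => i _; rewrite mxE -expr2 sqr_ge0.
pose s := Num.sqrt ((v *m v^T) 0 0).
have s0 : s != 0 by rewrite gt_eqF// sqrtr_gt0.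
pose u := s^-1 *: v.
have uV : u \in V by rewrite memvZ// memv_pick.
have uu : u *m u^T = 1%:M.
  apply/matrixP => a b; rewrite !ord1 linearZ/= -scalemxAl -scalemxAr scalerA.
  rewrite mxE [in RHS]mxE eqxx -[X in _ * X](@sqr_sqrtr _ ((v *m v^T) 0 0)) ?ltW//.
  by rewrite -/s expr2 mulrA mulfVK// mulVf.
pose W := (V :&: orthv <[u]>)%VS.
have u0 : u != 0 by rewrite scaler_eq0 invr_eq0 (negbTE s0).
have VE : (<[u]> + W = V)%VS.
  apply/eqP; rewrite eqEsubv subv_add capvSl -memvE uV/=.
  apply/subvP => x xV; have [p1 p2] := oprojP <[u]> x.
  rewrite -(subrK (oproj <[u]> x) x) addrC memv_add// memv_cap p2 andbT.
  by rewrite memvB//; apply: subvP p1; rewrite -memvE.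
have dW : \dim W = j.
  have : \dim (<[u]> + W)%VS = (\dim <[u]> + \dim W)%N.
    apply: dimv_disjoint_sum; apply/eqP; rewrite -subv0 -(capv_orthv <[u]>).
    by rewrite capvS ?capvSr.
  by rewrite VE dV dim_vline u0 => -[].
have [U [UU UW]] := IH _ dW.
have uU0 : U *m u^T = 0.
  apply/row_matrixP => i; rewrite row_mul row0.
  by have /memv_capP[_ /mem_orthv] := UW i; apply; exact: memv_line.
have ZZ : col_mx u U *m (col_mx u U)^T = 1%:M.
  rewrite tr_col_mx mul_col_row uu UU uU0.
  rewrite -[u *m U^T]trmxK trmx_mul trmxK uU0 trmx0.
  by rewrite (scalar_mx_block 1 j).
exists (col_mx u U : 'M[R]_(1 + j, n)); split; first exact: ZZ.
move=> i; rewrite -(@splitK 1 j i); case: (@fintype.split 1 j i) => k /=.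
  by have := rowKu k u U; rewrite [k]ord1 row_id => ->.
by have := rowKd k u U => ->; have /memv_capP[] := UW k.
Qed.

Lemma orthonormal_basisP (R : realType) (n j : nat) (jn : (j <= n)%N)
    (xi : grassmannian (R := R) jn) :
  orthonormal_basis xi (get (orthonormal_basis xi)).
Proof.
by apply: getPex; apply: orthonormal_mx_exists; exact/eqP/(valP xi).
Qed.

(* Main.v *)
Require Import Defs.
From HB Require Import structures.
From mathcomp Require Import all_boot all_order all_algebra.
From mathcomp Require Import all_classical all_reals all_analysis.
From mathcomp Require Import measurable_realfun ring lra.
Import Order.TTheory GRing.Theory Num.Theory.
Import numFieldNormedType.Exports.

Set Implicit Arguments.
Unset Strict Implicit.
Unset Printing Implicit Defensive.

Local Open Scope classical_set_scope.
Local Open Scope ring_scope.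

(* The j-th root of the volume of a projection is superadditive, by the
   Brunn-Minkowski inequality in R^j; the integral with exponent -n preserves
   this. We use Brunn-Minkowski in the multiplicative form
   |(1-t) X + t Y| >= |X|^(1-t) |Y|^t, which goes through an induction on the
   dimension: the volumes of the hyperplane sections satisfy the same inequality,
   and the one-dimensional Prekopa-Leindler inequality, applied to them after
   division by their suprema, integrates it. With
   a^j = Phi(K) / omega_n, b^j = Phi(L) / omega_n and t = eps b / (a + eps b),
   every projection satisfies
   vol(K + eps L) >= (a + eps b)^j (vol K / a^j)^(1-t) (vol L / b^j)^t;
   raising to the power -n, bounding the product by a convex combination and
   integrating gives the theorem.
     The integrals are additive only because the volume of the projection is a
   measurable function of the subspace. It is in fact upper semicontinuous. Since
   the orthonormal frame of each subspace is an arbitrary choice, this needs the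
   behaviour of the Lebesgue measure under linear maps, obtained without
   determinants by comparing with the Euclidean ball, which is nearly preserved
   by a near isometry. *)

(** * Lebesgue measure on R^n *)

(** The products of two exhaustions cover the plane because both can be taken increasing: a point
    whose coordinates enter at stages [n] and [m] lies in the product at stage [maxn n m]. *)
Lemma sigma_finite_product_measure1 d1 d2 (X : measurableType d1)
    (Y : measurableType d2) (R : realType)
    (m1 : {sigma_finite_measure set X -> \bar R})
    (m2 : {sigma_finite_measure set Y -> \bar R}) :
  sigma_finite setT (m1 \x m2)%E.
Proof.
have /sigma_finiteP[F [TF ndF Foo]] := sigma_finiteT m1.
have /sigma_finiteP[G [TG ndG Goo]] := sigma_finiteT m2.
exists (fun n => F n `*` G n); last first.
  move=> k; have [mF mFoo] := Foo k; have [mG mGoo] := Goo k.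
  split; first exact: measurableX.
  by rewrite product_measure1E// lte_mul_pinfty// ge0_fin_numE.
apply/esym/seteqP; split => // -[x y] _.
have [n _ Fx] : (\bigcup_k F k) x by rewrite -TF.
have [m _ Gy] : (\bigcup_k G k) y by rewrite -TG.
exists (maxn n m) => //; split => /=.
  by apply: (subsetPset _ _ (ndF _ _ (leq_maxl n m))).
by apply: (subsetPset _ _ (ndG _ _ (leq_maxr n m))).
Qed.

Lemma sigma_finite_pushforward d1 d2 (X : measurableType d1)
    (Y : measurableType d2) (R : realType) (f : X -> Y) (g : Y -> X)
    (mu : {measure set X -> \bar R}) : sigma_finite setT mu ->
    measurable_fun setT f -> measurable_fun setT g -> cancel f g ->
  exists nu : {sigma_finite_measure set Y -> \bar R},
    forall A, nu A = mu (f @^-1` A).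
Proof.
move=> mu_sf mf mg fK.
have mfpre A : measurable A -> measurable (f @^-1` A).
  by move=> mA; rewrite -[X in measurable X]setTI; exact: mf.
have mgpre A : measurable A -> measurable (g @^-1` A).
  by move=> mA; rewrite -[X in measurable X]setTI; exact: mg.
pose nu : set Y -> \bar R := fun A => mu (f @^-1` A).
have nu0 : nu set0 = 0%E by rewrite /nu preimage_set0 measure0.
have nu_ge0 A : (0 <= nu A)%E by exact: measure_ge0.
have nu_sa : semi_sigma_additive nu.
  move=> F mF tF mUF; rewrite /nu preimage_bigcup.
  apply: measure_semi_sigma_additive.
  - by move=> n; exact: mfpre.
  - apply/trivIsetP => i j _ _ ij; rewrite -preimage_setI.
    by move/trivIsetP : tF => /(_ _ _ _ _ ij) ->//; rewrite preimage_set0.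
  - by rewrite -preimage_bigcup; exact: mfpre.
have nu_sf : sigma_finite setT nu.
  have [F FT F_fin] := mu_sf.
  exists (fun n => g @^-1` (F n)).
    by rewrite -preimage_bigcup -FT preimage_setT.
  move=> n; have [mF muF] := F_fin n; split; first exact: mgpre.
  rewrite /nu (_ : _ @^-1` _ = F n)//.
  by apply/seteqP; split => x /=; rewrite fK.
pose nu1 : {measure set Y -> \bar R} :=
  HB.pack nu (isMeasure.Build _ _ _ nu nu0 nu_ge0 nu_sa).
pose nu2 : {sigma_finite_measure set Y -> \bar R} :=
  HB.pack nu (Measure.on nu1) (Measure_isSigmaFinite.Build _ _ _ nu1 nu_sf).
by exists nu2.
Qed.

(** * Measure structure and slicing on tuples *)

Section LebesgueTuple.
Context {R : realType}.
Local Open Scope ereal_scope.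

Definition tcons n (p : measurableTypeR R * n.-tuple R) : n.+1.-tuple R :=
  [tuple of p.1 :: p.2].

Definition tuncons n (t : n.+1.-tuple R) : measurableTypeR R * n.-tuple R :=
  (thead t, [tuple of behead t]).

Lemma tconsK n : cancel (@tcons n) (@tuncons n).
Proof. by move=> [x t]; congr pair; exact/val_inj. Qed.

Lemma measurable_tcons n : measurable_fun setT (@tcons n).
Proof. by apply: measurable_cons => //; exact: measurable_fst. Qed.

Lemma measurable_tuncons n : measurable_fun setT (@tuncons n).
Proof.
apply/measurable_fun_pairP; split; first exact: measurable_tnth.
exact: measurable_behead.
Qed.

(** The existential form lets the induction run before [lebesgue_tuple] is declared a measure: the
    product in dimension [n.+1] needs a sigma-finite measure in dimension [n]. *)
Lemma lebesgue_tuple_sigma_finite n :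
  exists mu : {sigma_finite_measure set (n.-tuple R) -> \bar R},
    forall A, lebesgue_tuple A = mu A.
Proof.
elim: n => [|n [mu muE]].
  by unshelve eexists; first exact: (\d_([tuple] : 0.-tuple R)).
have lE : @lebesgue_tuple R n = mu by exact/funext.
have [nu nuE] := sigma_finite_pushforward
  (sigma_finite_product_measure1 (@lebesgue_measure R) mu)
  (@measurable_tcons n) (@measurable_tuncons n) (@tconsK n).
by exists nu => A; rewrite nuE /= lE.
Qed.

Lemma lebesgue_tuple_measure_axioms n :
  [/\ @lebesgue_tuple R n set0 = 0, forall A, 0 <= @lebesgue_tuple R n A,
      semi_sigma_additive (@lebesgue_tuple R n) &
      sigma_finite setT (@lebesgue_tuple R n)].
Proof.
have [mu /funext ->] := lebesgue_tuple_sigma_finite n.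
split => //; first exact: (@measure_semi_sigma_additive _ _ _ mu).
exact: (sigma_finiteT mu).
Qed.

Let lebesgue_tuple0 n : @lebesgue_tuple R n set0 = 0.
Proof. by case: (lebesgue_tuple_measure_axioms n). Qed.

Let lebesgue_tuple_ge0 n A : 0 <= @lebesgue_tuple R n A.
Proof. by case: (lebesgue_tuple_measure_axioms n). Qed.

Let lebesgue_tuple_sigma_additive n : semi_sigma_additive (@lebesgue_tuple R n).
Proof. by case: (lebesgue_tuple_measure_axioms n). Qed.

HB.instance Definition _ n := isMeasure.Build _ _ _ (@lebesgue_tuple R n)
  (lebesgue_tuple0 n) (@lebesgue_tuple_ge0 n) (@lebesgue_tuple_sigma_additive n).

Let lebesgue_tuple_sigma_finiteT n : sigma_finite setT (@lebesgue_tuple R n).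
Proof. by case: (lebesgue_tuple_measure_axioms n). Qed.

HB.instance Definition _ n := Measure_isSigmaFinite.Build _ _ _
  (@lebesgue_tuple R n) (lebesgue_tuple_sigma_finiteT n).

(** Slicing along the first coordinate; the inductions on the dimension that follow go through this
    formula. *)
Lemma lebesgue_tupleS n (A : set (n.+1.-tuple R)) :
  lebesgue_tuple A =
  \int[@lebesgue_measure R]_x lebesgue_tuple [set t | A (tcons (x, t))].
Proof.
by rewrite /= /product_measure1; apply: eq_integral => x _ /=; rewrite /xsection;
  congr lebesgue_tuple; apply/seteqP; split => t /=; rewrite in_setE.
Qed.

Lemma measurable_tcons_section n (A : set (n.+1.-tuple R)) x :
  measurable A -> measurable [set t | A (tcons (x, t))].
Proof.
move=> mA; have mA' : measurable (@tcons n @^-1` A).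
  by rewrite -[X in measurable X]setTI; exact: measurable_tcons.
have := measurable_xsection x mA'; rewrite /xsection.
by congr measurable; apply/seteqP; split => t /=; rewrite in_setE.
Qed.

Lemma measurable_lebesgue_tuple_section n (A : set (n.+1.-tuple R)) :
  measurable A ->
  measurable_fun [set: measurableTypeR R]
    (fun x => lebesgue_tuple [set t | A (tcons (x, t))]).
Proof.
move=> mA; have mA' : measurable (@tcons n @^-1` A).
  by rewrite -[X in measurable X]setTI; exact: measurable_tcons.
have := measurable_fun_xsection (@lebesgue_tuple R n) mA'.
congr measurable_fun; apply/funext => x /=; congr lebesgue_tuple.
by rewrite /xsection; apply/seteqP; split => t /=; rewrite in_setE.
Qed.

End LebesgueTuple.

(** * Dilations, translations and cubes *)

Section AffineChange.
Context {R : realType}.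
Implicit Types (a b : R).

(** By uniqueness of Lebesgue measure: [a] times its image under x -> a x + b gives every half-open
    interval its length. *)
Lemma lebesgue_measure_affine a b (A : set R) : 0 < a -> measurable A ->
  lebesgue_measure ((fun x => a * x + b) @^-1` A) =
  (a^-1%:E * lebesgue_measure A)%E.
Proof.
move=> a0 mA.
have mphi : measurable_fun [set: measurableTypeR R]
    ((fun x => a * x + b) : _ -> measurableTypeR R).
  by apply: measurable_funD => //; exact: measurable_funM.
pose nu0 : {measure set (measurableTypeR R) -> \bar R} :=
  measure_function_pushforward__canonical__measure_function_Measure
   (@lebesgue_measure R) mphi.
pose nu := mscale (NngNum (ltW a0)) nu0.
have muE : lebesgue_measure A = nu A.
  apply: lebesgue_measure_unique => // _ [[c d] /= cd <-].
  rewrite /nu /mscale /nu0 /= /pushforward.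
  rewrite (_ : _ @^-1` _ = `](c - b) / a, (d - b) / a]%classic).
    rewrite !lebesgue_measure_itv/= !lte_fin ltr_pM2r ?invr_gt0// ltrD2r.
    case: ifPn => _; last by rewrite mule0.
    by rewrite -!EFinD -EFinM; congr EFin; field; lra.
  apply/seteqP; split => x /=; rewrite !in_itv/= ltr_pdivrMr// ler_pdivlMr//;
    by rewrite ltrBlDr lerBrDr (mulrC x).
rewrite muE /nu /mscale /nu0/= /pushforward muleA -EFinM mulVf ?mul1e//.
by rewrite gt_eqF.
Qed.

Lemma ge0_integral_affine a b (f : R -> \bar R) : 0 < a ->
  measurable_fun [set: R] f -> (forall x, 0 <= f x)%E ->
  (\int[lebesgue_measure]_x f (a * x + b)%R =
   a^-1%:E * \int[lebesgue_measure]_x f x)%E.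
Proof.
move=> a0 mf f0.
have mphi : measurable_fun [set: measurableTypeR R]
    ((fun x => a * x + b) : _ -> measurableTypeR R).
  by apply: measurable_funD => //; exact: measurable_funM.
have ia0 : 0 <= a^-1 by rewrite invr_ge0 ltW.
rewrite -(@ge0_integral_mscale _ _ _ lebesgue_measure _ measurableT (NngNum ia0)) //.
pose phi : measurableTypeR R -> measurableTypeR R := fun x => a * x + b.
transitivity (\int[pushforward lebesgue_measure phi]_x f x)%E.
  by rewrite (ge0_integral_pushforward mphi)// => ? _; exact: f0.
apply: (@eq_measure_integral _ _ _ setT (mscale (NngNum ia0) lebesgue_measure)
  (measure_function_pushforward__canonical__measure_function_Measure
   (@lebesgue_measure R) mphi)) => A mA _.
exact: lebesgue_measure_affine.
Qed.

Definition taffine n a (v t : n.-tuple R) : n.-tuple R :=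
  [tuple a * tnth t i + tnth v i | i < n].

Lemma taffine_tcons n a (v : n.+1.-tuple R) x t :
  taffine a v (tcons (x, t)) =
  tcons (a * x + thead v, taffine a [tuple of behead v] t).
Proof.
apply: eq_from_tnth => i; rewrite tnth_mktuple.
case: (unliftP ord0 i) => [k|] ->; last by rewrite /tcons !tnth0.
by rewrite /tcons/= !tnthS tnth_mktuple [in LHS](tuple_eta v) tnthS.
Qed.

(** The slice of the preimage at [x] is the affine preimage of the slice of [A] at
    [a * x + thead v], so each dimension contributes one factor 1/a. *)
Lemma lebesgue_tuple_affine n a (v : n.-tuple R) A : 0 < a -> measurable A ->
  lebesgue_tuple (taffine a v @^-1` A) =
  ((a ^- n)%:E * lebesgue_tuple A)%E.
Proof.
move=> a0; elim: n v A => [|n IH] v A mA.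
  rewrite expr0 invr1 mul1e; congr lebesgue_tuple.
  by apply/seteqP; split => t /=; rewrite [taffine _ _ _]tuple0 [t]tuple0.
pose g x := lebesgue_tuple [set t | A (tcons (x, t))].
have mg : measurable_fun [set: R] g by exact: measurable_lebesgue_tuple_section.
have g0 x : (0 <= g x)%E by exact: measure_ge0.
rewrite !lebesgue_tupleS.
transitivity (\int[lebesgue_measure]_x ((a ^- n)%:E * g (a * x + thead v)%R))%E.
  apply: eq_integral => x _.
  rewrite -(IH [tuple of behead v]); last exact: measurable_tcons_section.
  by congr lebesgue_tuple; apply/seteqP; split => t /=; rewrite taffine_tcons.
rewrite ge0_integralZl//; last 2 first.
  have mphi : measurable_fun [set: measurableTypeR R]
    ((fun x => a * x + thead v) : _ -> measurableTypeR R).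
    by apply: measurable_funD => //; exact: measurable_funM.
  exact: (measurableT_comp mg mphi).
  by rewrite lee_fin invr_ge0 exprn_ge0// ltW.
rewrite ge0_integral_affine// muleA -EFinM; congr ((_)%:E * _)%E.
by rewrite exprSr invfM.
Qed.

Lemma lebesgue_tuple_cube n r : 0 <= r ->
  lebesgue_tuple [set t : n.-tuple R | forall i, `|tnth t i| <= r] =
  ((r *+ 2) ^+ n)%:E.
Proof.
move=> r0; elim: n => [|n IH].
  rewrite expr0 /= diracE mem_set//=; by case.
rewrite lebesgue_tupleS.
transitivity (\int[lebesgue_measure]_(x in `[(- r)%R, r]) ((r *+ 2) ^+ n)%:E)%E.
  rewrite [RHS]integral_mkcond; apply: eq_integral => x _.
  rewrite patchE mem_setE in_itv/= -ler_norml; case: ifPn => xr.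
    rewrite -IH; congr lebesgue_tuple; apply/seteqP; split => t /= tr i.
      by have := tr (lift ord0 i); rewrite tnthS.
    by case: (unliftP ord0 i) => [k|] ->; rewrite ?tnthS ?tnth0.
  rewrite -[RHS](@measure0 _ _ _ (@lebesgue_tuple R n)).
  congr lebesgue_tuple; apply/seteqP; split => t //= /(_ ord0).
  by rewrite tnth0/= (negbTE xr).
rewrite integral_cst//= lebesgue_measure_itv/= lte_fin.
have [r_gt0|] := ltrP (-r) r.
  by rewrite -EFinD -EFinM opprK exprSr.
move=> rr; have -> : r = 0 by lra.
by rewrite mule0 mul0rn expr0n.
Qed.

Lemma measurable_tuple_cube n r :
  measurable [set t : n.-tuple R | forall i, `|tnth t i| <= r].
Proof.
rewrite [X in measurable X](_ : _ = \bigcap_(i in [set: 'I_n])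
    ((fun t => tnth t i) @^-1` [set` `[- r, r]])); last first.
  apply/seteqP; split => t /= tr i; first by move=> _; rewrite /= in_itv/= -ler_norml.
  by have := tr i Logic.I; rewrite /= in_itv/= -ler_norml.
apply: fin_bigcap_measurable => // i _.
by rewrite -[X in measurable X]setTI; apply: measurable_tnth.
Qed.

Lemma lebesgue_tuple_bounded n r (A : set (n.-tuple R)) : measurable A ->
  (forall t, A t -> forall i, `|tnth t i| <= r) -> (lebesgue_tuple A < +oo)%E.
Proof.
(* The absolute value is taken because [r] may be negative, while a cube needs a nonnegative
   half-side. *)
move=> mA Ar; apply: (@le_lt_trans _ _ ((`|r| *+ 2) ^+ n)%:E); last exact: ltry.
rewrite -lebesgue_tuple_cube//; apply: le_measure; rewrite ?inE//.
  exact: measurable_tuple_cube.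
by move=> t /Ar tr i; apply: le_trans (tr i) (ler_norm _).
Qed.

End AffineChange.

(** Tonelli for an indicator function: the two iterated integrals are measures that agree on
    rectangles, hence equal by uniqueness of the product measure. *)
Lemma integral_sectionC d1 d2 (X : measurableType d1) (Y : measurableType d2)
    (R : realType) (m1 : {sigma_finite_measure set X -> \bar R})
    (m2 : {sigma_finite_measure set Y -> \bar R}) (W : set (X * Y)) :
  measurable W ->
  (\int[m1]_x m2 [set y | W (x, y)] = \int[m2]_y m1 [set x | W (x, y)])%E.
Proof.
move=> mW.
have := @product_measure_unique _ _ _ _ _ m1 m2 (m1 \x^ m2)%E
  (fun A B mA mB => product_measure2E m1 m2 mA mB) W mW.
rewrite /product_measure1/= /product_measure2 => WE.
transitivity (\int[m1]_x (m2 \o xsection W) x)%E.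
  apply: eq_integral => x _ /=; congr (m2 _).
  by apply/seteqP; split => y /=; rewrite /xsection /= in_setE.
rewrite [LHS]WE; apply: eq_integral => x _ /=; congr (m1 _).
by apply/seteqP; split => y /=; rewrite /ysection /= in_setE.
Qed.

(** * Borel sets of row vectors and linear changes of variables *)

Section RowMeasurability.
Context {R : realType} {n : nat}.
Implicit Types (A B : set 'rV[R]_n) (N : 'M[R]_n).

Definition tuple_row (t : n.-tuple R) : 'rV[R]_n := \row_i tnth t i.

Definition row_tuple (x : 'rV[R]_n) : n.-tuple R := [tuple x 0 i | i < n].

Definition measurable_rV A := measurable (tuple_row @^-1` A).

Lemma row_tupleK : cancel row_tuple tuple_row.
Proof. by move=> x; apply/rowP => i; rewrite mxE tnth_mktuple. Qed.

(** The sigma-algebra is generated by the coordinates, so an open set is exhibited as a countable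
    union of cubes with rational centres and radii 1/(k+1). *)
Lemma open_measurable_rV A : open A -> measurable_rV A.
Proof.
move=> oA.
pose cube (q : n.-tuple rat * nat) : set (n.-tuple R) :=
  [set t | forall i, `|tnth t i - ratr (tnth q.1 i)| < q.2.+1%:R^-1].
(* [F q] is the cube [q] when that cube lies in the open set, and is empty otherwise. *)
pose F q := cube q `&` [set _ | cube q `<=` tuple_row @^-1` A].
rewrite /measurable_rV; have -> : tuple_row @^-1` A = \bigcup_q F q.
  apply/seteqP; split => [t At|t [q _ [qt]]]; last exact.
  have /nbhs_ballP[e /= e0 eA] : nbhs (tuple_row t) A by exact: open_nbhs_nbhs.
  (* Two points of one cube differ by less than twice its radius in each coordinate, hence the bound
     e/2. *)
  have [k ke] : exists k : nat, k.+1%:R^-1 < e / 2.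
    have := near_infty_natSinv_lt (PosNum (divr_gt0 e0 (ltr0Sn R 1))).
    by case=> k _ /(_ _ (leqnn k)) ?; exists k.
  have k0 : (0 : R) < k.+1%:R^-1 by rewrite invr_gt0.
  have qP i : exists q : rat, `|tnth t i - ratr q| < k.+1%:R^-1.
    have : tnth t i - k.+1%:R^-1 < tnth t i + k.+1%:R^-1.
      by rewrite ltrD2l (lt_trans _ k0)// oppr_lt0.
    move=> /rat_in_itvoo[q]; rewrite in_itv/= => /andP[q1 q2].
    by exists q; rewrite distrC ltr_distl q1.
  pose q := [tuple sval (cid (qP i)) | i < n].
  have qt : cube (q, k) t.
    by move=> i; rewrite tnth_mktuple; case: cid.
  exists (q, k) => //; split => // u qu; apply: eA; split => // i j.
  rewrite !mxE /ball /= -(subrKA (ratr (tnth q j))).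
  apply: (le_lt_trans (ler_normD _ _)); have := qt j; have := qu j.
  rewrite distrC /= => uk tk.
  by rewrite (splitr e) ltrD// (lt_trans _ ke).
apply: countable_bigcupT_measurable => // q.
have [qA|qA] := pselect (cube q `<=` tuple_row @^-1` A); last first.
  by rewrite (_ : F q = set0)//; apply/seteqP; split => // t [_ /qA].
rewrite (_ : F q = \bigcap_(i in [set: 'I_n]) ((fun t => tnth t i) @^-1`
    [set x | `|x - ratr (tnth q.1 i)| < q.2.+1%:R^-1])); last first.
  apply/seteqP; split => t /= tq; first by move=> i _; apply tq.
  by split => // i; exact: (tq i).
apply: fin_bigcap_measurable => // i _.
rewrite -[X in measurable X]setTI; apply: measurable_tnth => //.
have -> : [set x : R | `|x - ratr (tnth q.1 i)| < q.2.+1%:R^-1] =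
    ball (ratr (tnth q.1 i) : R) (q.2.+1%:R^-1).
  by apply/seteqP; split => x /=; rewrite /ball /= distrC.
exact: measurable_ball.
Qed.

Lemma closed_measurable_rV A : closed A -> measurable_rV A.
Proof.
move=> /closed_openC/open_measurable_rV/measurableC.
by rewrite /measurable_rV preimage_setC setCK.
Qed.

Lemma compact_measurable_rV A : compact A -> measurable_rV A.
Proof.
by move=> /(compact_closed (@norm_hausdorff R 'rV[R]_n))/closed_measurable_rV.
Qed.

Lemma measurable_row_tuple d (X : measurableType d) (f : X -> 'rV[R]_n) :
  (forall i, measurable_fun setT (fun x => f x 0 i)) ->
  measurable_fun setT (row_tuple \o f).
Proof.
move=> mf; apply/measurable_fun_tnthP => i.
rewrite (_ : _ \o _ = fun x => f x 0 i)//.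
by apply/funext => x /=; rewrite tnth_mktuple.
Qed.

Lemma measurable_rV_preimage d (X : measurableType d) (f : X -> 'rV[R]_n) A :
  (forall i, measurable_fun setT (fun x => f x 0 i)) ->
  measurable_rV A -> measurable (f @^-1` A).
Proof.
move=> /measurable_row_tuple mf mA.
rewrite (_ : _ @^-1` _ = (row_tuple \o f) @^-1` (tuple_row @^-1` A)).
  by rewrite -[X in measurable X]setTI; exact: mf.
by apply/seteqP; split => x /=; rewrite row_tupleK.
Qed.

Lemma lebesgue_rV_affine a (v : 'rV[R]_n) A : 0 < a -> measurable_rV A ->
  lebesgue_rV [set x | A (a *: x + v)] = ((a ^- n)%:E * lebesgue_rV A)%E.
Proof.
move=> a0 mA; rewrite -(lebesgue_tuple_affine (row_tuple v) a0 mA).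
congr lebesgue_tuple; apply/seteqP; split => t /=;
  by congr A; apply/rowP => i; rewrite !mxE !tnth_mktuple.
Qed.

Lemma lebesgue_rV_translate (v : 'rV[R]_n) A : measurable_rV A ->
  lebesgue_rV [set x | A (x + v)] = lebesgue_rV A.
Proof.
move=> mA; have := lebesgue_rV_affine v ltr01 mA.
rewrite expr1n invr1 mul1e => <-; congr lebesgue_rV.
by apply/seteqP; split => x /=; rewrite scale1r.
Qed.

Lemma measurable_tuple_row_mul N i :
  measurable_fun setT (fun t => (tuple_row t *m N) 0 i).
Proof.
rewrite (_ : (fun t => _) = fun t => \sum_k tnth t k * N k i); last first.
  by apply/funext => t; rewrite mxE; apply: eq_bigr => k _; rewrite mxE.
apply: measurable_sum => k; apply: measurable_funM => //.
exact: measurable_tnth.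
Qed.


Lemma measurable_rV_mul N A : measurable_rV A -> measurable_rV [set z | A (z *m N)].
Proof.
by move=> mA; apply: measurable_rV_preimage mA; exact: measurable_tuple_row_mul.
Qed.

(* Both sides are the measure of {(x, z) | B (z N) /\ A (x + z N)}: the left one
   by slicing along x, the right one after the shear z |-> z - x N^-1. *)
Lemma lebesgue_rV_mul_ratio N A B : N \in unitmx ->
  measurable_rV A -> measurable_rV B -> (forall x, B x -> B (- x)) ->
  (lebesgue_rV A * lebesgue_rV [set z | B (z *m N)] =
   lebesgue_rV [set z | A (z *m N)] * lebesgue_rV B)%E.
Proof.
move=> N_unit mA mB symB.
pose W := [set p : n.-tuple R * n.-tuple R |
  B (tuple_row p.2 *m N) /\ A (tuple_row p.1 + tuple_row p.2 *m N)].
pose W' := [set p : n.-tuple R * n.-tuple R |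
  B (tuple_row p.2 *m N - tuple_row p.1) /\ A (tuple_row p.2 *m N)].
have m1 i : measurable_fun [set: n.-tuple R * n.-tuple R]
    (fun p => tuple_row p.1 0 i).
  rewrite (_ : (fun _ => _) = (fun t => tnth t i) \o fst); last first.
    by apply/funext => p; rewrite mxE.
  by apply: measurableT_comp; [exact: measurable_tnth|exact: measurable_fst].
have m2 i : measurable_fun [set: n.-tuple R * n.-tuple R]
    (fun p => (tuple_row p.2 *m N) 0 i).
  exact: (measurableT_comp (measurable_tuple_row_mul N i) measurable_snd).
have mW : measurable W.
  apply: (measurableI _ _ (measurable_rV_preimage m2 mB)).
  apply: (@measurable_rV_preimage _ _
    (fun p => tuple_row p.1 + tuple_row p.2 *m N)) mA => i.
  by under eq_fun do rewrite mxE; exact: measurable_funD.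
have mW' : measurable W'.
  apply: measurableI (measurable_rV_preimage m2 mA).
  apply: (@measurable_rV_preimage _ _
    (fun p => tuple_row p.2 *m N - tuple_row p.1)) mB => i.
  rewrite (_ : (fun p => _) = fun p =>
      (tuple_row p.2 *m N) 0 i - tuple_row p.1 0 i); last first.
    by apply/funext => p; rewrite !mxE.
  exact: measurable_funB.
(* The shear acts on each slice as a translation, by [tuple_row s *m invmx N]. *)
have sectionWW' s : lebesgue_tuple [set t | W (s, t)] =
    lebesgue_tuple [set t | W' (s, t)].
  pose S := [set x : 'rV[R]_n | B (x *m N - tuple_row s) /\ A (x *m N)].
  have mS : measurable_rV S.
    have := measurable_xsection s mW'; congr measurable.
    by apply/seteqP; split => t; rewrite /xsection/= inE.
  rewrite -[RHS](lebesgue_rV_translate (tuple_row s *m invmx N) mS).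
  congr lebesgue_tuple; apply/seteqP; split => t;
    by rewrite /W/S/= mulmxDl mulmxKV// addrK addrC.
(* The integral is a product as soon as the integrand is the measure of [C] where [D (z *m N)] holds
   and zero elsewhere. *)
have constE (C D : set 'rV[R]_n) (F : n.-tuple R -> \bar R) :
    measurable_rV D -> measurable_rV C ->
    (forall t, D (tuple_row t *m N) -> F t = lebesgue_rV C) ->
    (forall t, ~ D (tuple_row t *m N) -> F t = 0%E) ->
    (\int[@lebesgue_tuple R n]_t F t =
     lebesgue_rV C * lebesgue_rV [set z | D (z *m N)])%E.
  move=> mD mC FD FnD.
  have mDN := measurable_rV_mul N mD.
  rewrite (_ : F = fun t => (lebesgue_rV C *
      (\1_(tuple_row @^-1` [set z | D (z *m N)]) t)%:E)%E); last first.
    apply/funext => t; rewrite indicE.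
    have [tD|tD] := pselect (D (tuple_row t *m N)).
      by rewrite mem_set// mule1 FD.
    by rewrite memNset// mule0 FnD.
  rewrite ge0_integralZl//=; last first.
    by apply: measurableT_comp => //; exact: measurable_indic.
  by rewrite integral_indic// setIT.
have := integral_sectionC (@lebesgue_tuple R n) (@lebesgue_tuple R n) mW'.
have := integral_sectionC (@lebesgue_tuple R n) (@lebesgue_tuple R n) mW.
rewrite (eq_integral _ _ (fun s _ => sectionWW' s)) => -> WE.
rewrite -(constE A B (fun t => lebesgue_tuple [set s | W (s, t)])) //; last 2 first.
- move=> t Bt; rewrite -(lebesgue_rV_translate (tuple_row t *m N) mA).
  by congr lebesgue_tuple; apply/seteqP; split => s /=; [case|].
- move=> t nBt; rewrite (_ : [set x | _] = set0) ?measure0//.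
  by apply/seteqP; split => s //= [].
rewrite WE [RHS]muleC -(constE B A (fun t => lebesgue_tuple [set s | W' (s, t)]))// => t.
(* The slice is the reflection of [B] moved by [tuple_row t *m N]; the symmetry of [B] makes it a
   translate of [B]. *)
- move=> At; rewrite -(lebesgue_rV_translate (- (tuple_row t *m N)) mB).
  congr lebesgue_tuple; apply/seteqP; split => s /=.
    by move=> [/symB]; rewrite opprB.
  by move=> /symB; rewrite opprB.
- move=> nAt; rewrite (_ : [set x | _] = set0) ?measure0//.
  by apply/seteqP; split => s //= [].
Qed.

End RowMeasurability.

(** * The Brunn-Minkowski inequality *)

Section OneDimensionalInequalities.
Context {R : realType}.
Local Notation mu := (@lebesgue_measure R).
Implicit Types (t : R) (A B C : set R) (f g h : R -> \bar R).

(** Young's inequality with the conjugate exponents 1/(1-t) and 1/t, applied to the two factors. *)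
Lemma weighted_AGM t (a b : R) : 0 < t < 1 -> 0 <= a -> 0 <= b ->
  a `^ (1 - t) * b `^ t <= (1 - t) * a + t * b.
Proof.
move=> /andP[t0 t1] a0 b0.
have s0 : 0 < 1 - t by rewrite subr_gt0.
have := @conjugate_powR R (a `^ (1 - t)) (b `^ t) (1 - t)^-1 t^-1
  (powR_ge0 _ _) (powR_ge0 _ _).
rewrite !invr_gt0 !invrK -!powRrM !divff ?gt_eqF// !powRr1//.
by rewrite mulrC (mulrC b) (mulrC a); apply => //; rewrite subrK.
Qed.

Lemma measurable_hypograph f : measurable_fun [set: R] f ->
  measurable [set p : measurableTypeR R * measurableTypeR R |
    0 < p.2 /\ (p.2%:E < f p.1)%E].
Proof.
move=> mf; pose W := [set p : measurableTypeR R * measurableTypeR R |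
  0 < p.2 /\ (p.2%:E < f p.1)%E].
rewrite -/W (_ : W = (snd @^-1` (`]0, +oo[ : set R)) `&`
    (setT `&` [set p | p.2%:E < f p.1]%E)); last first.
  apply/seteqP; split => p; rewrite /W /= in_itv/= andbT => -[p0 pf] //.
  by case: pf.
apply: measurableI.
  by rewrite -[X in measurable X]setTI; apply: measurable_snd.
apply: measurable_lte => //.
  by apply/measurable_EFinP; exact: measurable_snd.
by apply: measurableT_comp => //; exact: measurable_fst.
Qed.

(** Both sides measure the hypograph: its slice over [x] is the open interval from 0 to [f x], and
    its slice at height [s] is a superlevel set. *)
Lemma ge0_integral_layer_cake f :
  measurable_fun [set: R] f -> (forall x, 0 <= f x)%E ->
  (\int[mu]_x f x = \int[mu]_s mu [set x | (0 < s)%R /\ (s%:E < f x)%E])%E.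
Proof.
move=> mf f0.
pose W := [set p : measurableTypeR R * measurableTypeR R |
  0 < p.2 /\ (p.2%:E < f p.1)%E].
have mW : measurable W by exact: measurable_hypograph.
rewrite -(integral_sectionC (@lebesgue_measure R) (@lebesgue_measure R) mW).
apply: eq_integral => x _; rewrite /W /=.
have := f0 x; case: (f x) => [r| |]//=.
- rewrite lee_fin => r0; rewrite (_ : [set y | _] = `]0, r[%classic); last first.
    apply/seteqP; split => y /=; rewrite in_itv/= lte_fin; first by move=> [-> ->].
    by move=> /andP[-> ->].
  rewrite lebesgue_measure_itv/= lte_fin.
  have [_|] := ltP 0 r; first by rewrite sube0.
  by move=> r0'; congr EFin; apply/eqP; rewrite eq_le r0 r0'.
- move=> _; rewrite (_ : [set y | _] = `]0, +oo[%classic); last first.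
    apply/seteqP; split => y /=; rewrite in_itv/= ltry ?andbT; first by case.
    by move=> ->.
  by rewrite lebesgue_measure_itv/= ltry.
Qed.

(** Choose [a] in [A] near its supremum and [b] in [B] near its infimum. The part of [A] up to [a],
    moved by [b], and the part of [B] beyond [b], moved by [a], both lie in [C] and are separated by
    the point a + b. Each trimming costs at most e/2. *)
Lemma brunn_minkowski_1D (r : R) A B C :
  measurable A -> measurable B -> measurable C ->
  A !=set0 -> B !=set0 ->
  (forall x, A x -> `|x| <= r) -> (forall x, B x -> `|x| <= r) ->
  (forall x y, A x -> B y -> C (x + y)) ->
  (mu A + mu B <= mu C)%E.
Proof.
move=> mA mB mC A0 B0 Ar Br ABC.
have supA : has_sup A.
  by split => //; exists r => x /Ar; apply: le_trans; exact: ler_norm.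
have infB : has_inf B.
  by split => //; exists (- r) => x /Br; rewrite ler_norml => /andP[].
apply/lee_addgt0Pr => e e0.
have e20 : 0 < e / 2 by rewrite divr_gt0.
have [a Aa sa] := sup_adherent e20 supA.
have [b Bb ib] := inf_adherent e20 infB.
pose A' := A `&` `]-oo, a]%classic.
pose B' := B `&` `]b, +oo[%classic.
have mA' : measurable A' by exact: measurableI.
have mB' : measurable B' by exact: measurableI.
have leA : (mu A <= mu A' + (e / 2)%:E)%E.
  have -> : (e / 2)%:E = mu `]a, a + e / 2]%classic.
    by rewrite lebesgue_measure_itv/= lte_fin ltrDl e20 -EFinB addrC addKr.
  apply: le_trans (measureU2 (@lebesgue_measure R) mA' (measurable_itv _)).
  apply: le_measure; rewrite ?inE//; first exact: measurableU.
  move=> x Ax; have [xa|ax] := leP x a; [left|right]; rewrite /= ?in_itv/=.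
    by split => //=; rewrite in_itv/= xa.
  by rewrite ax/=; have := ub_le_sup supA.2 Ax; lra.
have leB : (mu B <= mu B' + (e / 2)%:E)%E.
  have -> : (e / 2)%:E = mu `[b - e / 2, b]%classic.
    rewrite lebesgue_measure_itv/= lte_fin ltrBlDr ltrDl e20 -EFinB opprB.
    by rewrite addrC subrK.
  apply: le_trans (measureU2 (@lebesgue_measure R) mB' (measurable_itv _)).
  apply: le_measure; rewrite ?inE//; first exact: measurableU.
  move=> x Bx; have [xb|bx] := ltP b x; [left|right]; rewrite /= ?in_itv/=.
    by split => //=; rewrite in_itv/= xb.
  by rewrite bx andbT; have := ge_inf infB.2 Bx; lra.
have shift (c : R) (D : set R) : measurable D ->
    mu ((fun x => 1 * x + c) @^-1` D) = mu D.
  by move=> mD; rewrite lebesgue_measure_affine// invr1 mul1e.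
have mshift (c : R) (D : set R) : measurable D ->
    measurable ((fun x : R => 1 * x + c) @^-1` D).
  move=> mD; rewrite -[X in measurable X]setTI.
  have : measurable_fun [set: R] (fun x : R => 1 * x + c).
    by apply: measurable_funD => //; exact: measurable_funM.
  exact.
apply: (@le_trans _ _ (mu A' + mu B' + e%:E)).
  rewrite [e in e%:E]splitr EFinD addeACA; exact: leeD.
rewrite leeD2r// -(shift (- b) A')// -(shift (- a) B')// -measureU//; last 3 first.
- exact: mshift.
- exact: mshift.
- apply/seteqP; split => x //= -[[_ xa] [_ xb]].
  by move: xa xb; rewrite /= !in_itv/= andbT !mul1r; lra.
apply: le_measure; rewrite ?inE//; first by apply: measurableU; exact: mshift.
move=> x /= [] [] /=; rewrite mul1r => Ax _.
  by have := ABC _ _ Ax Bb; rewrite subrK.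
by have := ABC _ _ Aa Ax; rewrite addrC subrK.
Qed.

End OneDimensionalInequalities.

(** * From superlevel sets on the line to sets in every dimension *)

Section BrunnMinkowski.
Context {R : realType}.
Local Notation mu := (@lebesgue_measure R).

Lemma measurable_superlevel (f : R -> \bar R) (s : R) :
  measurable_fun [set: R] f -> measurable [set x | (0 < s)%R /\ (s%:E < f x)%E].
Proof.
move=> mf; have [s0|s0] := pselect (0 < s); last first.
  by rewrite (_ : [set _ | _] = set0)//; apply/seteqP; split => x // [].
rewrite (_ : [set _ | _] = setT `&` [set x | s%:E < f x]%E).
  exact: emeasurable_fun_o_infty.
by apply/seteqP; split => x //=; case.
Qed.

Lemma measurable_superlevel_measure (f : R -> \bar R) :
  measurable_fun [set: R] f ->
  measurable_fun [set: measurableTypeR R]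
    (fun s : R => mu [set x | (0 < s)%R /\ (s%:E < f x)%E]).
Proof.
move=> mf; have mW := measurable_hypograph mf.
have := measurable_fun_ysection (@lebesgue_measure R) mW.
congr measurable_fun; apply/funext => s /=; congr lebesgue_measure.
by rewrite /ysection; apply/seteqP; split => x /=; rewrite inE.
Qed.

(** By the layer cake formula it suffices to compare superlevel sets at each height [s]. For s < 1
    those of [f] and [g] are nonempty, since both functions come arbitrarily close to 1, and the
    one-dimensional Brunn-Minkowski inequality applies to their dilates by 1-t and t. For s >= 1
    both are empty. *)
Lemma prekopa_leindler_1D (t r : R) (f g h : R -> \bar R) : 0 < t < 1 ->
  measurable_fun [set: R] f -> measurable_fun [set: R] g ->
  measurable_fun [set: R] h ->
  (forall x, 0 <= f x <= 1)%E -> (forall x, 0 <= g x <= 1)%E ->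
  (forall x, 0 <= h x)%E ->
  (forall x, (0 < f x)%E -> `|x| <= r) -> (forall x, (0 < g x)%E -> `|x| <= r) ->
  (forall s : R, s < 1 -> exists x, (s%:E < f x)%E) ->
  (forall s : R, s < 1 -> exists x, (s%:E < g x)%E) ->
  (forall s x y : R, 0 < s -> (s%:E < f x)%E -> (s%:E < g y)%E ->
    (s%:E < h ((1 - t) * x + t * y)%R)%E) ->
  ((1 - t)%:E * \int[mu]_x f x + t%:E * \int[mu]_x g x <= \int[mu]_x h x)%E.
Proof.
move=> /andP[t0 t1] mf mg mh f01 g01 h0 fr gr fsup gsup fgh.
have t'0 : 0 < 1 - t by rewrite subr_gt0.
have f0 x : (0 <= f x)%E by case/andP: (f01 x).
have g0 x : (0 <= g x)%E by case/andP: (g01 x).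
rewrite (ge0_integral_layer_cake mf f0) (ge0_integral_layer_cake mg g0).
rewrite (ge0_integral_layer_cake mh h0).
have mF := measurable_superlevel_measure mf.
have mG := measurable_superlevel_measure mg.
have mH := measurable_superlevel_measure mh.
rewrite -!ge0_integralZl ?lee_fin ?(ltW t0) ?(ltW t'0)//.
rewrite -ge0_integralD//; last 4 first.
- by move=> s _; rewrite mule_ge0// lee_fin ltW.
- exact: measurable_funeM.
- by move=> s _; rewrite mule_ge0// lee_fin ltW.
- exact: measurable_funeM.
apply: ge0_le_integral => //.
- by move=> s _; rewrite adde_ge0// mule_ge0// lee_fin ltW.
- by apply: emeasurable_funD; exact: measurable_funeM.
move=> s _ /=.
have [s0|s0] := pselect (0 < s); last first.
  have E (k : R -> \bar R) : [set x | (0 < s)%R /\ (s%:E < k x)%E] = set0.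
    by apply/seteqP; split => x // [].
  by rewrite !E measure0 !mule0 adde0.
have [s1|s1] := ltP s 1; last first.
  have E (k : R -> \bar R) : (forall x, 0 <= k x <= 1)%E ->
      [set x | (0 < s)%R /\ (s%:E < k x)%E] = set0.
    move=> k01; apply/seteqP; split => x // [_ sk]; have /andP[_] := k01 x.
    by rewrite leNgt (le_lt_trans _ sk).
  by rewrite (E f f01) (E g g01) measure0 !mule0 adde0.
have mscaled (a : R) (D : set R) : measurable D ->
    measurable ((fun x : R => a^-1 * x + 0) @^-1` D).
  move=> mD; rewrite -[X in measurable X]setTI.
  have : measurable_fun [set: R] (fun x : R => a^-1 * x + 0).
    by apply: measurable_funD => //; exact: measurable_funM.
  exact.
have scaled (a : R) (D : set R) : 0 < a -> measurable D ->
    (a%:E * mu D)%E = mu ((fun x => a^-1 * x + 0) @^-1` D).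
  by move=> a0 mD; rewrite lebesgue_measure_affine ?invr_gt0// invrK.
have mf' := measurable_superlevel s mf.
have mg' := measurable_superlevel s mg.
have mh' := measurable_superlevel s mh.
rewrite !scaled//.
have scaledK (a x : R) : 0 < a -> a^-1 * (a * x) + 0 = x.
  by move=> a0; rewrite mulrA mulVf ?gt_eqF// mul1r addr0.
(* Dilation by a factor below 1 keeps the superlevel sets within distance [r] of the origin. *)
have bnd (a x : R) (k : R -> \bar R) : 0 < a -> a < 1 ->
    (forall x, (0 < k x)%E -> `|x| <= r) -> (s%:E < k (a^-1 * x + 0)%R)%E ->
    `|x| <= r.
  move=> a0 a1 kr sk; have := kr _ (lt_trans _ sk).
  rewrite lte_fin addr0 => /(_ s0); rewrite normrM gtr0_norm ?invr_gt0// => xr.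
  apply: le_trans xr; rewrite ler_peMl// invf_ge1 ?ltW//.
have {fsup}[x0 fx0] := fsup s s1; have {gsup}[y0 gy0] := gsup s s1.
apply: (@brunn_minkowski_1D _ r); try exact: mscaled; try by [].
- by exists ((1 - t) * x0); rewrite /= scaledK.
- by exists (t * y0); rewrite /= scaledK.
- by move=> x [_ sx]; apply: (@bnd (1 - t) _ f) => //; lra.
- by move=> x [_ sx]; apply: (@bnd t _ g) => //; lra.
move=> x y [_ sx] [_ sy]; split => //.
have := fgh _ _ _ s0 sx sy; congr (_ < h _)%E.
by field; rewrite !gt_eqF.
Qed.

Definition tcomb n (t : R) (u v : n.-tuple R) : n.-tuple R :=
  [tuple (1 - t) * tnth u i + t * tnth v i | i < n].

Lemma tcomb_tcons n t x y (u v : n.-tuple R) :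
  tcomb t (tcons (x, u)) (tcons (y, v)) =
  tcons ((1 - t) * x + t * y, tcomb t u v).
Proof.
apply: eq_from_tnth => i; rewrite tnth_mktuple.
case: (unliftP ord0 i) => [k|] ->; last by rewrite !tnth0.
by rewrite !tnthS tnth_mktuple.
Qed.

(** Dividing the slice volumes of [A] and [B] by their suprema gives two functions with the same
    supremum 1, so the additive one-dimensional inequality applies. It bounds a weighted arithmetic
    mean, and passing to the geometric mean makes the normalizations cancel. *)
Lemma brunn_minkowski n (t r : R) (A B C : set (n.-tuple R)) : 0 < t < 1 ->
  measurable A -> measurable B -> measurable C ->
  (forall u, A u -> forall i, `|tnth u i| <= r) ->
  (forall u, B u -> forall i, `|tnth u i| <= r) ->
  (forall u v, A u -> B v -> C (tcomb t u v)) ->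
  ((fine (lebesgue_tuple A) `^ (1 - t) * fine (lebesgue_tuple B) `^ t)%:E <=
   lebesgue_tuple C)%E.
Proof.
move=> /[dup] t01 /andP[t0 t1].
have t'0 : 0 < 1 - t by rewrite subr_gt0.
elim: n A B C => [|n IH] A B C mA mB mC Ar Br ABC.
  (* In dimension 0 the measure is a point mass, so only emptiness matters; the positive exponents
     send 0 to 0. *)
  have [[u Au]|] := pselect (A !=set0); last first.
    move=> /set0P/negP/negPn/eqP ->; rewrite measure0 powR0 ?gt_eqF// mul0r.
    exact: measure_ge0.
  have [[v Bv]|] := pselect (B !=set0); last first.
    move=> /set0P/negP/negPn/eqP ->; rewrite measure0 powR0 ?gt_eqF// mulr0.
    exact: measure_ge0.
  have := ABC _ _ Au Bv; rewrite (tuple0 (tcomb _ _ _)) => C0.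
  have A0 : A [tuple] by rewrite -(tuple0 u).
  have B0 : B [tuple] by rewrite -(tuple0 v).
  by rewrite /= !diracE !mem_set//= !indicE !mem_set//= !mulr1n !powR1 mulr1.
have finE (D : set (n.+1.-tuple R)) (x : R) : measurable D ->
    (forall u, D u -> forall i, `|tnth u i| <= r) ->
    (lebesgue_tuple [set u | D (tcons (x, u))] < +oo)%E.
  move=> mD Dr; apply: (@lebesgue_tuple_bounded _ _ r) => //.
    exact: measurable_tcons_section.
  by move=> u /Dr ur i; have := ur (lift ord0 i); rewrite tnthS.
pose F (D : set (n.+1.-tuple R)) (x : R) :=
  fine (lebesgue_tuple [set u | D (tcons (x, u))]).
have F0 D x : 0 <= F D x by exact/fine_ge0/measure_ge0.
have FE (D : set (n.+1.-tuple R)) (x : R) : measurable D ->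
    (forall u, D u -> forall i, `|tnth u i| <= r) ->
    lebesgue_tuple [set u | D (tcons (x, u))] = (F D x)%:E.
  by move=> mD Dr; rewrite /F fineK// ge0_fin_numE ?measure_ge0// finE.
have lamE (D : set (n.+1.-tuple R)) : measurable D ->
    (forall u, D u -> forall i, `|tnth u i| <= r) ->
    lebesgue_tuple D = (\int[mu]_x (F D x)%:E)%E.
  by move=> mD Dr; rewrite lebesgue_tupleS; apply: eq_integral => x _; exact: FE.
have mF (D : set (n.+1.-tuple R)) : measurable D ->
    (forall u, D u -> forall i, `|tnth u i| <= r) ->
    measurable_fun [set: R] (fun x => (F D x)%:E).
  move=> mD Dr; have := measurable_lebesgue_tuple_section mD.
  by congr measurable_fun; apply/funext => x; rewrite FE.
have Fub (D : set (n.+1.-tuple R)) : measurable D ->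
    (forall u, D u -> forall i, `|tnth u i| <= r) ->
    has_ubound (range (F D)).
  move=> mD Dr; exists ((`|r| *+ 2) ^+ n) => _ [x _ <-].
  rewrite -lee_fin -FE// -lebesgue_tuple_cube//.
  apply: le_measure; rewrite ?inE.
  - exact: measurable_tcons_section.
  - exact: measurable_tuple_cube.
  move=> u /Dr ur i; apply: le_trans (ler_norm r).
  by have := ur (lift ord0 i); rewrite tnthS.
have supF (D : set (n.+1.-tuple R)) : measurable D ->
    (forall u, D u -> forall i, `|tnth u i| <= r) ->
    lebesgue_tuple D != 0%E -> 0 < sup (range (F D)).
  move=> mD Dr; apply: contra_neqT; rewrite -leNgt => sup0.
  rewrite lamE//; apply: integral0_eq => x _; congr EFin; apply/eqP.
  rewrite eq_le F0 andbT (le_trans _ sup0)//.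
  by apply: ub_le_sup; [exact: Fub|exists x].
(* A null set makes the left side zero; otherwise the supremum of its slice volumes is positive and
   can be divided by. *)
have [->|A0] := eqVneq (lebesgue_tuple A) 0%E.
  by rewrite powR0 ?gt_eqF// mul0r measure_ge0.
have [->|B0] := eqVneq (lebesgue_tuple B) 0%E.
  by rewrite powR0 ?gt_eqF// mulr0 measure_ge0.
have := supF _ mA Ar A0; set MA := sup _ => MA0.
have := supF _ mB Br B0; set MB := sup _ => MB0.
(* The normalization of the slices of [C] has to be the geometric mean of the other two. *)
pose N := MA `^ (1 - t) * MB `^ t.
have N0 : 0 < N by rewrite mulr_gt0// powR_gt0.
have normF (D : set (n.+1.-tuple R)) (M : R) : 0 < M -> measurable D ->
    (forall u, D u -> forall i, `|tnth u i| <= r) ->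
    [/\ measurable_fun [set: R] (fun x => (M^-1 * F D x)%:E) &
      (M^-1%:E * lebesgue_tuple D = \int[mu]_x (M^-1 * F D x)%:E)%E].
  move=> M0 mD Dr; split.
    by under eq_fun do rewrite EFinM; apply: measurable_funeM; exact: mF.
  rewrite lamE// -ge0_integralZl//; first exact: mF.
    by move=> x _; rewrite lee_fin.
  by rewrite lee_fin invr_ge0 ltW.
have [mfA fAE] := normF A MA MA0 mA Ar.
have [mfB fBE] := normF B MB MB0 mB Br.
pose h x := (N^-1%:E * lebesgue_tuple [set u | C (tcons (x, u))])%E.
have mh : measurable_fun [set: R] h.
  by apply: measurable_funeM; exact: measurable_lebesgue_tuple_section.
have hE : (N^-1%:E * lebesgue_tuple C = \int[mu]_x h x)%E.
  rewrite lebesgue_tupleS -ge0_integralZl//.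
    exact: measurable_lebesgue_tuple_section.
  by rewrite lee_fin invr_ge0 ltW.
have h0 x : (0 <= h x)%E by rewrite mule_ge0// lee_fin invr_ge0 ltW.
have supF1 (D : set (n.+1.-tuple R)) (M : R) :
    M = sup (range (F D)) -> 0 < M -> measurable D ->
    (forall u, D u -> forall i, `|tnth u i| <= r) ->
    [/\ forall x, (0 <= (M^-1 * F D x)%:E <= 1)%E,
       forall x, (0 < (M^-1 * F D x)%:E)%E -> `|x| <= r &
       forall s, s < 1 -> exists x, (s%:E < (M^-1 * F D x)%:E)%E].
  move=> ME M0 mD Dr; split.
  - move=> x; rewrite !lee_fin mulr_ge0 ?invr_ge0 ?(ltW M0)//=.
    rewrite ler_pdivrMl// mulr1 ME.
    by apply: ub_le_sup; [exact: Fub|exists x].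
  - move=> x; rewrite lte_fin pmulr_rgt0 ?invr_gt0// => Fx0.
    have [[u Du]|] := pselect ([set u | D (tcons (x, u))] !=set0).
      by have := Dr _ Du ord0; rewrite tnth0.
    move=> /set0P/negP/negPn/eqP E0.
    by move: Fx0; rewrite /F E0 measure0 ltxx.
  - move=> s s1; have MsM : 0 < M - s * M by rewrite subr_gt0 gtr_pMl.
    have [|_ [x _ <-]] := sup_adherent MsM (E := range (F D)).
      by split; [exists (F D 0), 0|exact: Fub].
    rewrite -ME subKr => sx; exists x.
    by rewrite lte_fin ltr_pdivlMl// mulrC.
have [fA01 fAr fAsup] := supF1 A MA erefl MA0 mA Ar.
have [fB01 fBr fBsup] := supF1 B MB erefl MB0 mB Br.
have := prekopa_leindler_1D t01 mfA mfB mh fA01 fB01 h0 fAr fBr fAsup fBsup.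
rewrite -hE -fAE -fBE => PL.
have {}PL : ((1 - t)%:E * (MA^-1%:E * lebesgue_tuple A) +
    t%:E * (MB^-1%:E * lebesgue_tuple B) <= N^-1%:E * lebesgue_tuple C)%E.
  (* Slices of volume above s MA and s MB have a geometric mean above s N, because s is the product
     of its powers 1-t and t; the induction hypothesis passes this on to the slice of [C]. *)
  apply: PL => s x y s0; rewrite !lte_fin => sx sy.
  rewrite /h; have := IH [set u | A (tcons (x, u))] [set u | B (tcons (y, u))]
    [set u | C (tcons ((1 - t) * x + t * y, u))].
  rewrite -/(F A x) -/(F B y) => IHxy.
  rewrite -(@lte_pmul2l _ N%:E)// ?lte_fin//.
  rewrite muleA -!EFinM divff ?gt_eqF// mul1e; apply: lt_le_trans (IHxy _ _ _ _ _ _).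
  - rewrite lte_fin /N.
    move: sx; rewrite ltr_pdivlMl// mulrC => sx.
    move: sy; rewrite ltr_pdivlMl// mulrC => sy.
    have -> : MA `^ (1 - t) * MB `^ t * s = (s * MA) `^ (1 - t) * (s * MB) `^ t.
      rewrite !powRM ?(ltW s0) ?(ltW MA0) ?(ltW MB0)//.
      rewrite mulrACA -powRD ?subrK ?powRr1 ?(ltW s0)//; last first.
        by rewrite gt_eqF ?implybT.
      by rewrite mulrC.
    apply: ltr_pM; rewrite ?powR_ge0//; apply: gt0_ltr_powR => //;
      by rewrite nnegrE ?F0// mulr_ge0// ltW.
  - exact: measurable_tcons_section.
  - exact: measurable_tcons_section.
  - exact: measurable_tcons_section.
  - by move=> u /Ar ur i; have := ur (lift ord0 i); rewrite tnthS.
  - by move=> u /Br ur i; have := ur (lift ord0 i); rewrite tnthS.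
  - by move=> u v /= Au Bv; rewrite -tcomb_tcons; exact: ABC.
have Afin : lebesgue_tuple A = (fine (lebesgue_tuple A))%:E.
  by rewrite fineK// ge0_fin_numE ?measure_ge0// (lebesgue_tuple_bounded mA Ar).
have Bfin : lebesgue_tuple B = (fine (lebesgue_tuple B))%:E.
  by rewrite fineK// ge0_fin_numE ?measure_ge0// (lebesgue_tuple_bounded mB Br).
move: PL; rewrite Afin Bfin -!EFinM -EFinD => PL.
set a := fine (lebesgue_tuple A) in PL *; set b := fine (lebesgue_tuple B) in PL *.
have a0 : 0 <= a by exact/fine_ge0/measure_ge0.
have b0 : 0 <= b by exact/fine_ge0/measure_ge0.
rewrite -(@lee_pmul2l _ N^-1%:E)// ?lte_fin ?invr_gt0//.
apply: le_trans PL; rewrite -EFinM lee_fin.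
(* The geometric mean of a/MA and b/MB is the wanted product divided by [N]. *)
apply: le_trans (weighted_AGM t01 _ _);
  rewrite ?mulr_ge0 ?invr_ge0 ?(ltW MA0) ?(ltW MB0)//.
rewrite !powRM ?invr_ge0 ?(ltW MA0) ?(ltW MB0)//.
have invE (x e : R) : 0 < x -> x^-1 `^ e = (x `^ e)^-1.
  by move=> x0; rewrite -powR_inv1 ?ltW// -powRrM mulN1r powRN.
by rewrite !invE// /N invfM mulrACA.
Qed.

End BrunnMinkowski.

(** * Semicontinuity of the volume of projections *)

Section EuclideanBall.
Context {R : realType} {n : nat}.
Implicit Types (x y : 'rV[R]_n) (A B C : set 'rV[R]_n).

Lemma measure_ge0_rV A : (0 <= lebesgue_rV A)%E.
Proof. exact: measure_ge0. Qed.

Lemma le_lebesgue_rV A B : measurable_rV A -> measurable_rV B ->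
  A `<=` B -> (lebesgue_rV A <= lebesgue_rV B)%E.
Proof. by move=> mA mB AB; apply: le_measure; rewrite ?inE// => t /AB. Qed.

Lemma lebesgue_rV_fin (r : R) A : measurable_rV A ->
  (forall x, A x -> forall i, `|x 0 i| <= r) -> lebesgue_rV A \is a fin_num.
Proof.
move=> mA Ar; rewrite ge0_fin_numE ?measure_ge0_rV//.
apply: (lebesgue_tuple_bounded (r := r)) => // t /Ar tr i.
by have := tr i; rewrite mxE.
Qed.

Lemma brunn_minkowski_rV (t r : R) A B C : 0 < t < 1 ->
  measurable_rV A -> measurable_rV B -> measurable_rV C ->
  (forall x, A x -> forall i, `|x 0 i| <= r) ->
  (forall x, B x -> forall i, `|x 0 i| <= r) ->
  (forall x y, A x -> B y -> C ((1 - t) *: x + t *: y)) ->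
  ((fine (lebesgue_rV A) `^ (1 - t) * fine (lebesgue_rV B) `^ t)%:E <=
   lebesgue_rV C)%E.
Proof.
move=> t01 mA mB mC Ar Br ABC.
apply: (brunn_minkowski (r := r) t01 mA mB mC).
- by move=> u /Ar ur i; have := ur i; rewrite mxE.
- by move=> u /Br ur i; have := ur i; rewrite mxE.
- move=> u v Au Bv; have := ABC _ _ Au Bv; rewrite /preimage /=.
  by congr C; apply/rowP => i; rewrite !mxE tnth_mktuple.
Qed.

Lemma lebesgue_rV_scale (a : R) A : 0 < a -> measurable_rV A ->
  lebesgue_rV [set x | A (a *: x)] = ((a ^- n)%:E * lebesgue_rV A)%E.
Proof.
move=> a0 mA; rewrite -(lebesgue_rV_affine 0 a0 mA); congr lebesgue_rV.
by apply/seteqP; split => x /=; rewrite addr0.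
Qed.

Lemma measurable_rV_scale (a : R) A : measurable_rV A ->
  measurable_rV [set x | A (a *: x)].
Proof.
move=> mA; rewrite (_ : [set x | _] = [set x | A (x *m a%:M)]).
  exact: measurable_rV_mul.
by apply/seteqP; split => x /=; rewrite mul_mx_scalar.
Qed.

Definition sqnorm x : R := \sum_i x 0 i ^+ 2.

Lemma sqnormE x : sqnorm x = (x *m x^T) 0 0.
Proof. by rewrite mxE; apply: eq_bigr => i _; rewrite mxE expr2. Qed.

Lemma sqnorm_ge0 x : 0 <= sqnorm x.
Proof. by apply: sumr_ge0 => i _; exact: sqr_ge0. Qed.

Lemma sqnormZ (a : R) x : sqnorm (a *: x) = a ^+ 2 * sqnorm x.
Proof. by rewrite /sqnorm mulr_sumr; apply: eq_bigr => i _; rewrite mxE exprMn. Qed.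

Lemma sqnormN x : sqnorm (- x) = sqnorm x.
Proof. by apply: eq_bigr => i _; rewrite mxE sqrrN. Qed.

Lemma coord_le_sqnorm (r : R) x i : 0 <= r -> sqnorm x <= r ^+ 2 -> `|x 0 i| <= r.
Proof.
move=> r0 xr; rewrite -(@ler_pXn2r _ 2)// ?nnegrE// real_normK ?num_real//.
apply: le_trans xr; rewrite /sqnorm (bigD1 i)//= lerDl.
by apply: sumr_ge0 => k _; exact: sqr_ge0.
Qed.

Definition eucl_ball (r : R) : set 'rV[R]_n := [set x | sqnorm x <= r ^+ 2].

Lemma measurable_eucl_ball r : measurable_rV (eucl_ball r).
Proof.
rewrite /measurable_rV (_ : _ @^-1` _ =
  (fun t => \sum_i tnth t i ^+ 2) @^-1` [set` `]-oo, r ^+ 2]]); last first.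
  have E t : sqnorm (tuple_row t) = \sum_i tnth t i ^+ 2.
    by apply: eq_bigr => i _; rewrite mxE.
  by apply/seteqP; split => t; rewrite /eucl_ball /= in_itv/= E.
rewrite -[X in measurable X]setTI.
have : measurable_fun [set: n.-tuple R] (fun t => \sum_i tnth t i ^+ 2).
  apply: measurable_sum => i; apply: measurable_funX; exact: measurable_tnth.
by apply => //; exact: measurable_itv.
Qed.

(** The ball contains the cube of half-side 1/(n+1): n squares, each at most 1/(n+1), sum to at most
    1. The successor keeps the half-side positive in dimension 0. *)
Lemma lebesgue_eucl_ball_gt0 : (0 < lebesgue_rV (eucl_ball 1))%E.
Proof.
have r0 : (0 : R) < n.+1%:R^-1 by rewrite invr_gt0.
apply: (@lt_le_trans _ _ (((n.+1%:R^-1 : R) *+ 2) ^+ n)%:E).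
  by rewrite lte_fin exprn_gt0// pmulrn_lgt0.
rewrite -(lebesgue_tuple_cube _ (ltW r0)); apply: le_measure; rewrite ?inE.
- exact: measurable_tuple_cube.
- exact: measurable_eucl_ball.
move=> t /= tr; rewrite /eucl_ball /= /sqnorm expr1n.
apply: (@le_trans _ _ (\sum_(i < n) (n.+1%:R^-1 : R))).
  apply: ler_sum => i _; rewrite mxE -real_normK ?num_real//.
  have ti := tr i; apply: (@le_trans _ _ (n.+1%:R^-1 ^+ 2)).
    by rewrite ler_pXn2r// nnegrE ltW.
  by rewrite expr2 ler_piMl ?(ltW r0)// invf_le1// ler1n.
rewrite sumr_const card_ord -[leLHS]mulr_natr ler_pdivrMl// mulr1 ler_nat.
exact: leqnSn.
Qed.

Lemma lebesgue_eucl_ball_fin r : 0 <= r -> lebesgue_rV (eucl_ball r) \is a fin_num.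
Proof.
move=> r0; apply: (@lebesgue_rV_fin r) => [|x xr i]; first exact: measurable_eucl_ball.
exact: coord_le_sqnorm.
Qed.

Lemma omegaE : omega R n = fine (lebesgue_rV (eucl_ball 1)).
Proof. by rewrite /omega /eucl_ball expr1n. Qed.

Lemma omega_gt0 : 0 < omega R n.
Proof.
rewrite omegaE fine_gt0// lebesgue_eucl_ball_gt0/=.
by rewrite -ge0_fin_numE ?measure_ge0_rV// lebesgue_eucl_ball_fin.
Qed.

Lemma lebesgue_eucl_ball r : 0 < r ->
  lebesgue_rV (eucl_ball r) = (r ^+ n * omega R n)%:E.
Proof.
move=> r0; rewrite omegaE EFinM fineK ?lebesgue_eucl_ball_fin//.
have r'0 : 0 < r^-1 by rewrite invr_gt0.
have := lebesgue_rV_scale r'0 (measurable_eucl_ball 1).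
rewrite exprVn invrK => <-; congr lebesgue_rV; apply/seteqP; split => x;
  by rewrite /eucl_ball /= sqnormZ expr1n exprVn ler_pdivrMl ?exprn_gt0// mulr1.
Qed.

End EuclideanBall.

(** * Linear images, sums and neighbourhoods of compact sets *)

Section CompactSets.
Context {R : realType}.

Lemma ler_norm_coord m n (M : 'M[R]_(m, n)) i j : `|M i j| <= `|M|.
Proof.
rewrite [leRHS]/Num.norm/= mx_normrE.
exact: (le_bigmax _ (fun k : 'I_m * 'I_n => `|M k.1 k.2|) (i, j)).
Qed.

Lemma ler_norm_mulmx_coord m n (x : 'rV[R]_m) (M : 'M[R]_(m, n)) (a c : R) i :
  (forall k, `|x 0 k| <= a) -> (forall k, `|M k i| <= c) ->
  `|(x *m M) 0 i| <= m%:R * (a * c).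
Proof.
move=> xa Mc; rewrite mxE; apply: le_trans (ler_norm_sum _ _ _) _.
rewrite mulr_natl -[X in _ *+ X]card_ord -sumr_const; apply: ler_sum => k _.
by rewrite normrM ler_pM.
Qed.

Lemma continuous_mulmxr m n (M : 'M[R]_(m, n)) :
  continuous (fun x : 'rV[R]_m => x *m M).
Proof.
move=> x; apply/(@cvgrPdist_lt _ _ _ (nbhs x) _ (fun y => y *m M)) => e e0.
(* Adding 1 to the norm and to [m] keeps the denominator of [d] nonzero, and m/(m+1) < 1 makes the
   final estimate strict. *)
pose c := `|M| + 1; have c0 : 0 < c by rewrite ltr_wpDl.
pose d := e / (m.+1%:R * c); have d0 : 0 < d by rewrite divr_gt0// mulr_gt0.
apply/nbhs_ballP; exists d => // y /= xy.
rewrite -mulmxBl [ltLHS]/Num.norm/= mx_normrE; apply/bigmax_ltP; split => // -[k i] _ /=.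
rewrite (ord1 k); apply: (@le_lt_trans _ _ (m%:R * (d * c))).
  apply: ler_norm_mulmx_coord => l.
    apply: ltW; move: xy; rewrite -ball_normE /= => xy.
    by apply: le_lt_trans xy; exact: ler_norm_coord.
  by apply: le_trans (ler_norm_coord M l i) _; rewrite lerDl.
have dcE : d * c = e / m.+1%:R by rewrite /d; field; rewrite gt_eqF//= gt_eqF.
by rewrite dcE mulrCA -ltr_pdivlMl// mulVf ?gt_eqF// ltr_pdivrMr// mul1r ltr_nat.
Qed.

Lemma compact_mulmxr m n (M : 'M[R]_(m, n)) (K : set 'rV[R]_m) :
  compact K -> compact [set x *m M | x in K].
Proof.
apply: continuous_compact; apply: continuous_subspaceT.
exact: continuous_mulmxr.
Qed.

Lemma compact_add n (A B : set 'rV[R]_n) : compact A -> compact B ->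
  compact [set z | exists x y, [/\ A x, B y & z = x + y]].
Proof.
move=> cA cB.
rewrite (_ : [set z | _] = (fun p => p.1 + p.2) @` (A `*` B)); last first.
  apply/seteqP; split => [z [x [y [Ax By ->]]]|_ [[x y] [/= Ax By] <-]].
    by exists (x, y).
  by exists x, y.
apply: continuous_compact; last exact: compact_setX.
by apply: continuous_subspaceT; exact: add_continuous.
Qed.

Lemma compact_coord_bounded n (K : set 'rV[R]_n) : compact K ->
  exists2 r : R, 0 < r & forall x, K x -> forall i, `|x 0 i| <= r.
Proof.
move=> /compact_bounded/pinfty_ex_gt0[r r0 Kr]; exists r => // x Kx i.
by apply: le_trans (ler_norm_coord x 0 i) _; exact: Kr.
Qed.

(** The Minkowski sum of [A] with the closed cube of half-side [d]; the cube being compact, the sum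
    inherits compactness from [A]. *)
Definition thickening n (d : R) (A : set 'rV[R]_n) : set 'rV[R]_n :=
  [set y | exists2 x, A x & forall i, `|y 0 i - x 0 i| <= d].

Lemma compact_thickening n d (A : set 'rV[R]_n) : compact A ->
  compact (thickening d A).
Proof.
move=> cA.
have cQ : compact [set v : 'rV[R]_n | forall i, `[- d, d]%classic (v ord0 i)].
  by apply: (@rV_compact R n (fun=> `[- d, d]%classic)) => i; exact: segment_compact.
have := compact_add cA cQ; congr compact; apply/seteqP; split => z.
  move=> [x [y [Ax Qy ->]]]; exists x => // i.
  by have := Qy i; rewrite /= in_itv/= -ler_norml mxE [x 0 i + _]addrC addrK.
move=> [x Ax zx]; exists x, (z - x); split => //; last by rewrite addrC subrK.
by move=> i /=; rewrite in_itv/= -ler_norml !mxE.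
Qed.

(** Continuity from above along the radii 1/(k+1): these neighbourhoods have finite measure and
    decrease to [A], because a compact set is closed. *)
Lemma lebesgue_rV_thickening n (A : set 'rV[R]_n) (t : \bar R) : compact A ->
  (lebesgue_rV A < t)%E ->
  exists2 d, 0 < d & (lebesgue_rV (thickening d A) < t)%E.
Proof.
move=> cA At; apply: contrapT => noD.
pose F k := tuple_row @^-1` thickening (k.+1%:R^-1 : R) A.
have mF k : measurable_rV (thickening (k.+1%:R^-1 : R) A).
  exact: (compact_measurable_rV (compact_thickening cA)).
have FA : \bigcap_k F k = tuple_row @^-1` A.
  apply/seteqP; split => u; last first.
    by move=> Au k _; exists (tuple_row u) => // i; rewrite subrr normr0 invr_ge0.
  move=> Fu; have /closure_id cE := compact_closed (@norm_hausdorff R 'rV[R]_n) cA.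
  rewrite /preimage/= cE => W /nbhs_ballP[e /= e0 eW].
  have [k ke] : exists k : nat, k.+1%:R^-1 < e.
    by have [k _ /(_ _ (leqnn k)) ?] := near_infty_natSinv_lt (PosNum e0); exists k.
  have [x Ax xu] := Fu k Logic.I; exists x; split => //; apply: eW; split => // i j.
  by rewrite (ord1 i) /ball/=; apply: le_lt_trans ke; exact: xu.
have ndF : {homo F : m k / (m <= k)%N >-> (k <= m)%O}.
  move=> m k mk; apply/subsetPset => u [x Ax ux]; exists x => // i.
  by apply: le_trans (ux i) _; rewrite lef_pV2 ?posrE// ler_nat.
have F0 : (lebesgue_tuple (F 0%N) < +oo)%E.
  have [r _ Tr] := compact_coord_bounded (compact_thickening (d := 1) cA).
  apply: (lebesgue_tuple_bounded (r := r)); first exact: (mF 0%N).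
  move=> u; rewrite /F invr1 => Fu i.
  by have := Tr _ Fu i; rewrite mxE.
have := nonincreasing_cvg_mu F0 mF _ ndF.
rewrite FA => /(_ (compact_measurable_rV cA)) cvgF.
have : (t <= lebesgue_rV A)%E.
  apply: cvge_ge cvgF; apply: nearW => k; rewrite leNgt; apply/negP => Fk.
  by apply: noD; exists k.+1%:R^-1 => //; rewrite invr_gt0.
by rewrite leNgt At.
Qed.

End CompactSets.

(** * Stability of the volume of a shadow under a change of frame *)

Section OrthonormalFrames.
Context {R : realType}.

Lemma bernoulli_le (e : R) k : 0 <= e <= 1 -> 1 - k%:R * e <= (1 - e) ^+ k.
Proof.
move=> /andP[e0 e1]; elim: k => [|k IH]; first by rewrite mul0r subr0.
rewrite exprS; apply: (@le_trans _ _ ((1 - e) * (1 - k%:R * e))).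
  have : 0 <= k%:R * e * e by rewrite !mulr_ge0.
  by rewrite -natr1; lra.
by rewrite ler_wpM2l// subr_ge0.
Qed.

(** Each product of two coordinates is at most half the sum of their squares; summing over all pairs
    yields n times the squared norm. *)
Lemma quadratic_form_le n (y : 'rV[R]_n) (D : 'M[R]_n) (d : R) :
  (forall i k, `|D i k| <= d) -> `|(y *m D *m y^T) 0 0| <= d * n%:R * sqnorm y.
Proof.
move=> Dd; rewrite mxE; apply: le_trans (ler_norm_sum _ _ _) _.
apply: (@le_trans _ _ (\sum_i \sum_k d * ((y 0 k ^+ 2 + y 0 i ^+ 2) / 2))).
  apply: ler_sum => i _; rewrite mxE big_distrl/=.
  apply: le_trans (ler_norm_sum _ _ _) _; apply: ler_sum => k _.
  rewrite mxE normrM normrM mulrAC mulrC; apply: ler_pM => //.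
  rewrite -normrM ler_norml.
  have := sqr_ge0 (y 0 k - y 0 i); have := sqr_ge0 (y 0 k + y 0 i).
  by rewrite !expr2 => ? ?; apply/andP; split; lra.
have -> : d * n%:R * sqnorm y =
    \sum_(i < n) \sum_(k < n) d * ((y 0 k ^+ 2 + y 0 i ^+ 2) / 2).
  under eq_bigr => i _ do
    rewrite -mulr_sumr -mulr_suml big_split/= sumr_const card_ord -/(sqnorm y).
  rewrite -mulr_sumr -mulr_suml big_split/= sumr_const card_ord sumrMnl.
  by rewrite -/(sqnorm y) -[sqnorm y *+ n]mulr_natr; field.
by [].
Qed.

Lemma sqnorm_mulmx j n (U : 'M[R]_(j, n)) (z : 'rV[R]_j) :
  U *m U^T = 1%:M -> sqnorm (z *m U) = sqnorm z.
Proof. by move=> UU; rewrite !sqnormE trmx_mul mulmxA -(mulmxA z) UU mulmx1. Qed.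

Lemma orthonormal_entry_le1 j n (U : 'M[R]_(j, n)) i k :
  U *m U^T = 1%:M -> `|U i k| <= 1.
Proof.
move=> UU; have := @coord_le_sqnorm R n 1 (row i U) k ler01.
rewrite mxE expr1n; apply; rewrite rowE sqnorm_mulmx// /sqnorm (bigD1 i)//=.
rewrite big1 => [|l li]; last by rewrite mxE (negbTE li) andbF expr0n.
by rewrite mxE !eqxx expr1n addr0.
Qed.

(* A frame U whose projection matrix U^T U is close to U0^T U0 need not be close
   to U0 itself, but U0 U^T is then a near isometry of R^j carrying K U^T into a
   small neighbourhood of K U0^T. *)
Lemma lebesgue_rV_shadow_usc j n (K : set 'rV[R]_n) (U0 : 'M[R]_(j, n)) (t : R) :
  compact K -> U0 *m U0^T = 1%:M ->
  (lebesgue_rV [set x *m U0^T | x in K] < t%:E)%E ->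
  exists2 d, 0 < d & forall U : 'M[R]_(j, n), U *m U^T = 1%:M ->
    (forall i k, `|(U^T *m U - U0^T *m U0) i k| <= d) ->
    (lebesgue_rV [set x *m U^T | x in K] < t%:E)%E.
Proof.
move=> cK UU0 Kt.
pose X0 := [set x *m U0^T | x in K]; have cX0 : compact X0 by exact: compact_mulmxr.
have mX0 := compact_measurable_rV cX0.
have [r0 _ X0r] := compact_coord_bounded cX0.
have X0fin := lebesgue_rV_fin mX0 X0r.
pose v := fine (lebesgue_rV X0).
have v0 : 0 <= v by exact/fine_ge0/measure_ge0_rV.
have vE : lebesgue_rV X0 = v%:E by rewrite fineK.
have vt : v < t by rewrite -lte_fin -vE.
have t0 : 0 < t by exact: le_lt_trans vt.
have j2 : (0 : R) < j.+2%:R by [].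
(* By Bernoulli, (1-e)^j t is at least t - (t-v) j/(j+2), which exceeds [v]. The denominator j+2
   also gives e < 1 when j = 0. *)
pose e := (t - v) / (t * j.+2%:R).
have e0 : 0 < e by rewrite divr_gt0 ?subr_gt0// mulr_gt0.
have e1 : e < 1.
  rewrite ltr_pdivrMr ?mulr_gt0// mul1r; apply: (@le_lt_trans _ _ t); first by lra.
  by rewrite ltr_pMr// ltr1n.
pose s := 1 - e.
have s0 : 0 < s by rewrite subr_gt0.
have s1 : s < 1 by rewrite /s; lra.
have sj0 : 0 < s ^+ j by rewrite exprn_gt0.
have vst : v < s ^+ j * t.
  apply: (@lt_le_trans _ _ ((1 - j%:R * e) * t)); last first.
    by rewrite ler_pM2r// bernoulli_le// ?ltW//= !ltW.
  have -> : (1 - j%:R * e) * t = t - (t - v) * (j%:R / j.+2%:R).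
    by rewrite /e; field; rewrite !gt_eqF.
  have : (t - v) * (j%:R / j.+2%:R) < t - v.
    by rewrite gtr_pMr ?subr_gt0// ltr_pdivrMr// mul1r ltr_nat.
  by rewrite ltrBrDl -ltrBrDr.
have [d1 d10 X0d1] : exists2 d, 0 < d &
    (lebesgue_rV (thickening d X0) < (s ^+ j * t)%:E)%E.
  by apply: lebesgue_rV_thickening => //; rewrite vE lte_fin.
have [r r_gt0 Kr] := compact_coord_bounded cK.
pose c := n%:R * (n%:R * r) + 1; have c0 : 0 < c.
  by rewrite ltr_wpDl// !mulr_ge0// ltW.
(* The first bound makes [N] below shrink lengths by a factor no smaller than [s]; the second keeps
   the displacement of the shadow within [d1]. *)
pose d := Num.min ((1 - s ^+ 2) / n.+1%:R) (d1 / c).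
have s21 : 0 < 1 - s ^+ 2 by rewrite subr_gt0 expr_lt1// ltW.
have d_gt0 : 0 < d by rewrite lt_min !divr_gt0.
exists d => // U UU Ud.
pose N := U *m U0^T.
(* The squared norms of [z] and [z *m N] differ by the quadratic form of the difference of the
   projection matrices at [z *m U]. *)
have near_isometry z : s ^+ 2 * sqnorm z <= sqnorm (z *m N).
  have := quadratic_form_le (z *m U) Ud.
  rewrite sqnorm_mulmx// mulmxBr mulmxBl mxE [in X in _ + X]mxE.
  have -> : (z *m U *m (U^T *m U) *m (z *m U)^T) 0 0 = sqnorm z.
    by rewrite mulmxA -(mulmxA z) UU mulmx1 -sqnormE sqnorm_mulmx.
  have -> : (z *m U *m (U0^T *m U0) *m (z *m U)^T) 0 0 = sqnorm (z *m N).
    by rewrite sqnormE /N !trmx_mul !trmxK !mulmxA.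
  rewrite ler_norml => /andP[_] h; have dn : d * n%:R <= 1 - s ^+ 2.
    apply: (@le_trans _ _ ((1 - s ^+ 2) / n.+1%:R * n%:R)).
      by rewrite ler_wpM2r// ge_min lexx.
    by rewrite mulrAC ler_pdivrMr// ler_wpM2l ?(ltW s21)// ler_nat.
  have := ler_wpM2r (sqnorm_ge0 z) dn.
  by rewrite mulrBl mul1r; lra.
have N_unit : N \in unitmx.
  rewrite -row_free_unit -kermx_eq0; apply/eqP/row_matrixP => i; rewrite row0.
  set z := row i _; have zN : z *m N = 0 by rewrite -row_mul mulmx_ker row0.
  apply/dot_eq0/matrixP => a b; rewrite !ord1 -sqnormE mxE.
  have := near_isometry z; rewrite zN.
  have -> : sqnorm (0 : 'rV[R]_j) = 0.
    by rewrite /sqnorm big1// => k _; rewrite mxE expr0n.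
  rewrite pmulr_rle0 ?exprn_gt0// => z0.
  by apply/eqP; rewrite eq_le z0 sqnorm_ge0.
have XN : [set x *m U^T | x in K] `<=` [set z | thickening d1 X0 (z *m N)].
  move=> _ [x Kx <-]; exists (x *m U0^T); first by exists x.
  (* The displacement of a shadow point involves the frames only through the difference of
     projection matrices, followed by [U0^T]. *)
  have E : x *m (U^T *m U - U0^T *m U0) *m U0^T = x *m U^T *m N - x *m U0^T.
    rewrite mulmxBr mulmxBl; congr (_ - _); first by rewrite /N !mulmxA.
    by rewrite -!mulmxA UU0 mulmx1.
  move=> i; have -> : (x *m U^T *m N) 0 i - (x *m U0^T) 0 i =
    (x *m (U^T *m U - U0^T *m U0) *m U0^T) 0 i by rewrite E !mxE.
  apply: (@le_trans _ _ (n%:R * ((n%:R * (r * d)) * 1))).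
    apply: ler_norm_mulmx_coord => k.
      by apply: ler_norm_mulmx_coord => l; [exact: Kr|exact: Ud].
    by rewrite mxE; exact: orthonormal_entry_le1.
  have -> : n%:R * (n%:R * (r * d) * 1) = n%:R * (n%:R * r) * d by ring.
  apply: (@le_trans _ _ (c * d)).
    by rewrite ler_wpM2r ?(ltW d_gt0)// lerDl.
  by rewrite mulrC -ler_pdivlMr// ge_min lexx orbT.
have mX := compact_measurable_rV (compact_mulmxr (M := U^T) cK).
have mT := compact_measurable_rV (compact_thickening (d := d1) cX0).
have mTN := measurable_rV_mul N mT.
apply: le_lt_trans (le_lebesgue_rV mX mTN XN) _.
have mB := @measurable_eucl_ball R j 1.
have BN (x : 'rV[R]_j) : eucl_ball 1 x -> eucl_ball 1 (- x).
  by rewrite /eucl_ball /= sqnormN.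
(* Pulling back along [N] multiplies every volume by the same factor, so the factor is read off on
   the unit ball: its pullback lies in the ball of radius 1/s, and the factor is at most s^-j. *)
have ratio := lebesgue_rV_mul_ratio N_unit mT mB BN.
have leB : (lebesgue_rV [set z | eucl_ball 1 (z *m N)] <=
    (s ^- j * omega R j)%:E)%E.
  rewrite -exprVn -lebesgue_eucl_ball ?invr_gt0//.
  apply: le_lebesgue_rV; [exact: measurable_rV_mul|exact: measurable_eucl_ball|].
  move=> z; rewrite /eucl_ball /= expr1n exprVn => zN.
  rewrite -[leRHS]mul1r ler_pdivlMr ?exprn_gt0// mulrC.
  exact: le_trans (near_isometry z) zN.
have om0 := omega_gt0 (R := R) (n := j).
rewrite -(@lte_pmul2r _ (omega R j)%:E)// ?lte_fin//.
move: ratio; rewrite lebesgue_eucl_ball// expr1n mul1r => <-.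
apply: (@le_lt_trans _ _
  (lebesgue_rV (thickening d1 X0) * (s ^- j * omega R j)%:E)%E).
  by apply: lee_wpmul2l => //; exact: measure_ge0_rV.
apply: (@lt_le_trans _ _ ((s ^+ j * t)%:E * (s ^- j * omega R j)%:E)%E).
  by rewrite lte_pmul2r// lte_fin mulr_gt0// invr_gt0.
rewrite -!EFinM lee_fin le_eqVlt; apply/orP; left; apply/eqP.
by field; rewrite gt_eqF.
Qed.

End OrthonormalFrames.

(** * Volumes of projections as functions on the Grassmannian *)

Section Projections.
Context {R : realType} {n j : nat}.

(** The rows of [U] are independent because [U^T] inverts [U] on the right, and there are as many of
    them as the dimension of [V]. *)
Lemma orthonormal_span (V : {vspace 'rV[R]_n}) (U : 'M[R]_(j, n)) y :
  \dim V = j -> U *m U^T = 1%:M -> (forall i, row i U \in V) ->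
  y \in V -> exists c : 'rV[R]_j, y = c *m U.
Proof.
move=> dV UU UV yV.
pose X := [tuple row i U | i < j].
have XE (k : 'I_j -> R) : \sum_i k i *: X`_i = (\row_i k i) *m U.
  rewrite mulmx_sum_row; apply: eq_bigr => i _.
  by rewrite -tnth_nth tnth_mktuple mxE.
have freeX : free X.
  apply/freeP => k; rewrite XE => kU i.
  have : (\row_i k i) *m U *m U^T = 0 by rewrite kU mul0mx.
  by rewrite -mulmxA UU mulmx1 => /rowP/(_ i); rewrite !mxE.
have XV : (<<X>> <= V)%VS.
  by apply/span_subvP => _ /tnthP[i ->]; rewrite tnth_mktuple.
have XVE : <<X>>%VS = V.
  by apply/eqP; rewrite eqEdim XV dV (eqP freeX) size_tuple leqnn.
move: yV; rewrite -XVE => /coord_span ->.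
by exists (\row_i coord X i y); rewrite XE.
Qed.

Lemma oprojE (V : {vspace 'rV[R]_n}) (U : 'M[R]_(j, n)) x :
  \dim V = j -> U *m U^T = 1%:M -> (forall i, row i U \in V) ->
  oproj V x = x *m U^T *m U.
Proof.
move=> dV UU UV; have [pV /mem_orthv xp] := oprojP V x.
have [c pE] := orthonormal_span dV UU UV pV.
have xpU : (x - oproj V x) *m U^T = 0.
  apply/rowP => i; rewrite [RHS]mxE.
  have /matrixP/(_ 0 0) := xp _ (UV i); rewrite [RHS]mxE => <-.
  by rewrite !mxE; apply: eq_bigr => k _; rewrite !mxE.
move: xpU; rewrite mulmxBl => /subr0_eq ->.
by rewrite pE -!mulmxA (mulmxA U) UU mul1mx.
Qed.

Context (jn : (j <= n)%N).
Implicit Types (xi : grassmannian (R := R) jn) (K : set 'rV[R]_n).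

(** The basis in which [gvol] reads off volumes. It is an arbitrary choice for each subspace, so no
    continuity in [xi] can be expected of it. *)
Definition frame xi : 'M[R]_(j, n) := get (orthonormal_basis xi).

Lemma frame_orthonormal xi : frame xi *m (frame xi)^T = 1%:M.
Proof. by case: (orthonormal_basisP xi). Qed.

Lemma oproj_frame xi x : oproj (gspace xi) x = x *m (frame xi)^T *m frame xi.
Proof.
have [UU UV] := orthonormal_basisP xi.
by apply: oprojE => //; exact/eqP/(valP xi).
Qed.

(** The left side defines the topology of the Grassmannian, and the right side is what the
    semicontinuity estimate compares. *)
Lemma gproj_mxE xi : gproj_mx xi = (frame xi)^T *m frame xi.
Proof.
apply/row_matrixP => i; rewrite !rowE mul_rV_lin1/= oproj_frame.
by rewrite mulmxA.
Qed.

(** Since the frame is orthonormal, its transpose recovers coordinates; projecting and then reading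
    coordinates is a single linear map. *)
Lemma gvol_projection xi K : gvol xi (projection K xi) =
  fine (lebesgue_rV [set x *m (frame xi)^T | x in K]).
Proof.
rewrite /gvol -/(frame xi); congr (fine (lebesgue_rV _)).
have UU := frame_orthonormal xi.
apply/seteqP; split => c /=.
  move=> [x Kx]; rewrite oproj_frame => /(congr1 (fun y => y *m (frame xi)^T)).
  by rewrite -!mulmxA UU !mulmx1 => <-; exists x.
by move=> [x Kx <-]; exists x => //; rewrite oproj_frame.
Qed.

Lemma lebesgue_rV_shadow_fin xi K : compact K ->
  lebesgue_rV [set x *m (frame xi)^T | x in K] \is a fin_num.
Proof.
move=> /(compact_mulmxr (M := (frame xi)^T)) cK.
have [r _ Kr] := compact_coord_bounded cK.
exact: lebesgue_rV_fin (compact_measurable_rV cK) Kr.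
Qed.

Lemma gvol_projectionE xi K : compact K ->
  lebesgue_rV [set x *m (frame xi)^T | x in K] =
  (gvol xi (projection K xi))%:E.
Proof. by move=> cK; rewrite gvol_projection fineK// lebesgue_rV_shadow_fin. Qed.

(** Upper semicontinuity: nearby subspaces have projection matrices that are close entry by entry,
    which is all that [lebesgue_rV_shadow_usc] asks of their frames. *)
Lemma open_gvol_lt K (t : R) : compact K ->
  open [set xi : grassmannian jn | gvol xi (projection K xi) < t].
Proof.
move=> cK; rewrite openE => xi /= xit.
have [|d d0 dP] := lebesgue_rV_shadow_usc (t := t) cK (frame_orthonormal xi).
  by rewrite gvol_projectionE// lte_fin.
have cont : continuous (@gproj_mx R n j jn) by exact: initial_continuous.
have nP := cont xi _ (nbhsx_ballx (gproj_mx xi) d d0).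
apply: (@filterS _ (nbhs xi) _ _ _ _ nP) => eta [_ etaB] /=.
rewrite -lte_fin -gvol_projectionE//; apply: dP; first exact: frame_orthonormal.
move=> i k; have subE (A B : 'M[R]_n) : (A - B) i k = A i k - B i k by rewrite !mxE.
rewrite -!gproj_mxE subE distrC ltW//.
exact: etaB.
Qed.

Lemma measurable_gvol K : compact K ->
  measurable_fun [set: @borel_grassmannian R n j jn]
    (fun xi => gvol xi (projection K xi)).
Proof.
move=> cK; apply: (measurability _ (RGenInftyO.measurableE R)).
move=> _ [_ [t ->] <-]; rewrite setTI; apply: sub_sigma_algebra.
rewrite (_ : _ @^-1` _ = [set xi : grassmannian jn | gvol xi (projection K xi) < t]).
  exact: open_gvol_lt.
by apply/seteqP; split => xi /=; rewrite in_itv.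
Qed.

(** Uniformly in the subspace, a shadow contains a fixed ball, since [K] contains one around the
    origin, and lies in a fixed cube. This makes negative powers of the volume bounded and their
    means positive. *)
Lemma gvol_bounds K : compact K -> K° 0 ->
  exists a b : R, [/\ 0 < a, 0 < b &
    forall xi, a <= gvol xi (projection K xi) <= b].
Proof.
move=> cK K0.
have [r r0 Kr] := compact_coord_bounded cK.
have /nbhs_ballP[e /= e0 eK] : nbhs (0 : 'rV[R]_n) K by [].
(* Half of [e] places the closed Euclidean ball of radius [s] inside the open sup-norm ball of
   radius [e]. *)
pose s := e / 2; have s0 : 0 < s by rewrite divr_gt0.
pose q := n%:R * (r * 1) + 1; have q0 : 0 < q.
  by rewrite ltr_wpDl// !mulr_ge0// ltW.
have om0 := omega_gt0 (R := R) (n := j).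
exists (s ^+ j * omega R j), ((q *+ 2) ^+ j); split.
- by rewrite mulr_gt0// exprn_gt0.
- by rewrite exprn_gt0// pmulrn_lgt0.
move=> xi; have UU := frame_orthonormal xi.
have mK := compact_measurable_rV (compact_mulmxr (M := (frame xi)^T) cK).
rewrite -!lee_fin -gvol_projectionE// -lebesgue_eucl_ball//; apply/andP; split.
  apply: le_lebesgue_rV => //; first exact: measurable_eucl_ball.
  move=> c cs; exists (c *m frame xi); last by rewrite -mulmxA UU mulmx1.
  apply: eK; split => // i k; rewrite (ord1 i) mxE /ball/= sub0r normrN.
  apply: (@le_lt_trans _ _ s); last by rewrite /s; lra.
  by apply: coord_le_sqnorm; rewrite ?(ltW s0)// sqnorm_mulmx.
rewrite -(lebesgue_tuple_cube _ (ltW q0)); apply: le_measure; rewrite ?inE.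
- exact: mK.
- exact: measurable_tuple_cube.
move=> t [x Kx xt] i /=.
have -> : tnth t i = (x *m (frame xi)^T) 0 i by rewrite xt mxE.
apply: (@le_trans _ _ (n%:R * (r * 1))); last by rewrite lerDl.
apply: ler_norm_mulmx_coord => k; first exact: Kr.
by rewrite mxE; exact: orthonormal_entry_le1.
Qed.

End Projections.

(** * Affine quermassintegrals *)

Section MinkowskiCombinations.
Context {R : realType} {n : nat}.
Implicit Types (K L : set 'rV[R]_n).

Lemma compact_minkowski_comb K L (eps : R) :
  compact K -> compact L -> compact (minkowski_comb K eps L).
Proof.
move=> cK /(compact_mulmxr (M := eps%:M)) cL; have := compact_add cK cL.
congr compact; apply/seteqP; split => z.
  move=> [x [_ [Kx [y Ly <-] ->]]]; exists x, y; split => //.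
  by rewrite mul_mx_scalar.
move=> [x [y [Kx Ly ->]]]; exists x, (y *m eps%:M); split => //; first by exists y.
by rewrite mul_mx_scalar.
Qed.

Lemma interior_minkowski_comb K L (eps : R) :
  K° 0 -> L 0 -> (minkowski_comb K eps L)° 0.
Proof.
move=> K0 L0; apply: (@filterS _ (nbhs (0 : 'rV[R]_n)) _ K) => // x Kx.
by exists x, 0; rewrite scaler0 addr0.
Qed.

(** Here 1-t = a/s and t = eps b/s, so the shadow of the Minkowski combination contains the convex
    combinations of the shadow of [K] dilated by s/a and that of [L] dilated by s/b. The dilations
    account for the powers of [s], [a] and [b]. *)
Lemma lebesgue_rV_shadow_minkowski j (M : 'M[R]_(n, j)) K L (eps a b s t : R) :
  compact K -> compact L -> 0 < eps -> 0 < a -> 0 < b ->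
  s = a + eps * b -> t = eps * b / s ->
  ((s ^+ j * ((fine (lebesgue_rV [set x *m M | x in K]) / a ^+ j) `^ (1 - t) *
    (fine (lebesgue_rV [set x *m M | x in L]) / b ^+ j) `^ t))%:E <=
   lebesgue_rV [set x *m M | x in minkowski_comb K eps L])%E.
Proof.
move=> cK cL eps0 a0 b0 sE tE.
have s0 : 0 < s by rewrite sE addr_gt0// mulr_gt0.
have t1 : 1 - t = a / s.
  have aE : a = s - eps * b by rewrite sE addrK.
  by rewrite tE aE; field; rewrite gt_eqF.
have t01 : 0 < t < 1.
  apply/andP; split; first by rewrite tE divr_gt0// mulr_gt0.
  by rewrite -subr_gt0 t1 divr_gt0.
set X := [set x *m M | x in K]; set Y := [set x *m M | x in L].
have cX : compact X by exact: compact_mulmxr.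
have cY : compact Y by exact: compact_mulmxr.
have mX := compact_measurable_rV cX; have mY := compact_measurable_rV cY.
have cZ := compact_mulmxr (M := M) (compact_minkowski_comb (eps := eps) cK cL).
have [rX rX0 Xr] := compact_coord_bounded cX.
have [rY rY0 Yr] := compact_coord_bounded cY.
have as0 : 0 < a / s by rewrite divr_gt0.
have bs0 : 0 < b / s by rewrite divr_gt0.
pose r := rX / (a / s) + rY / (b / s).
have := @brunn_minkowski_rV R j t r [set x | X ((a / s) *: x)]
  [set y | Y ((b / s) *: y)] _ t01 (measurable_rV_scale _ mX)
  (measurable_rV_scale _ mY) (compact_measurable_rV cZ).
have coordE (c : R) (x : 'rV[R]_j) i q : 0 < c -> `|(c *: x) 0 i| <= q ->
    `|x 0 i| <= q / c.
  by move=> c0; rewrite mxE normrM gtr0_norm// mulrC ler_pdivlMr.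
have Ar (x : 'rV[R]_j) : X ((a / s) *: x) -> forall i, `|x 0 i| <= r.
  move=> Xx i; apply: le_trans (coordE _ _ _ _ as0 (Xr _ Xx i)) _.
  by rewrite lerDl divr_ge0// ltW.
have Br (x : 'rV[R]_j) : Y ((b / s) *: x) -> forall i, `|x 0 i| <= r.
  move=> Yx i; apply: le_trans (coordE _ _ _ _ bs0 (Yr _ Yx i)) _.
  by rewrite lerDr divr_ge0// ltW.
move=> /(_ Ar Br) BM; apply: le_trans (BM _); last first.
  move=> x y [x1 Kx1 x1E] [y1 Ly1 y1E]; exists (x1 + eps *: y1).
    by exists x1, y1.
  rewrite t1 mulmxDl x1E -scalemxAl y1E scalerA; congr (_ + _ *: _).
  by rewrite tE; field; rewrite !gt_eqF.
rewrite !lebesgue_rV_scale// !fineM ?(lebesgue_rV_fin mX Xr) ?(lebesgue_rV_fin mY Yr)//.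
set p := fine (lebesgue_rV X); set q := fine (lebesgue_rV Y).
have p0 : 0 <= p by exact/fine_ge0/measure_ge0_rV.
have q0 : 0 <= q by exact/fine_ge0/measure_ge0_rV.
have scaleE (c v : R) : 0 < c -> (c / s) ^- j * v = s ^+ j * (v / c ^+ j).
  by move=> c0; rewrite expr_div_n; field; rewrite !expf_neq0// gt_eqF.
rewrite lee_fin /= !scaleE//.
have sj0 : 0 <= s ^+ j by rewrite exprn_ge0// ltW.
rewrite !powRM ?divr_ge0 ?exprn_ge0 ?invr_ge0 ?exprn_ge0 ?(ltW a0) ?(ltW b0) ?(ltW s0)//.
rewrite [leRHS]mulrACA -powRD ?subrK ?powRr1//.
by rewrite oner_eq0.
Qed.

End MinkowskiCombinations.

(** * Integration over the Grassmannian *)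

Section AffineQuermassintegrals.
Context {R : realType} {n j : nat} (n_ge1 : (1 <= n)%N) (j_ge1 : (1 <= j)%N)
  (jn : (j <= n)%N) (mu : probability (@borel_grassmannian R n j jn) R).
Implicit Types (K L : set 'rV[R]_n).

Definition shadow_power K (xi : grassmannian (R := R) jn) : R :=
  (gvol xi (projection K xi) / omega R j) ^- n.

Definition shadow_mean K : R := \int[mu]_xi shadow_power K xi.

(** This is I^(-1/(nj)): at the mean of the shadow powers of [K] it is the j-th root of the affine
    quermassintegral divided by the volume of the unit ball. *)
Definition root_inv (I : R) : R := (I `^ (- n%:R^-1)) `^ j%:R^-1.

Lemma affine_quermass_root K :
  affine_quermass mu K `^ j%:R^-1 =
  omega R n `^ j%:R^-1 * root_inv (shadow_mean K).
Proof. by rewrite /affine_quermass powRM ?powR_ge0// ltW// omega_gt0. Qed.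

Lemma powR_exprVn (x e : R) k : 0 <= x -> (x `^ e) ^- k = (x ^- k) `^ e.
Proof.
move=> x0; transitivity (x `^ (- (e * k%:R))).
  by rewrite powRN powRrM powR_mulrn ?powR_ge0.
by rewrite -[in RHS](powR_mulrn k x0) -powRN -powRrM; congr (_ `^ _); ring.
Qed.

(** The integrand is measurable and lies between two positive constants, and the total mass is 1. *)
Lemma shadow_power_integrable K : compact K -> K° 0 ->
  mu.-integrable setT (EFin \o shadow_power K) /\ 0 < shadow_mean K.
Proof.
move=> cK K0; have [a [b [a0 b0 abP]]] := gvol_bounds jn cK K0.
have om0 := omega_gt0 (R := R) (n := j).
have bounds xi : (b / omega R j) ^- n <= shadow_power K xi <= (a / omega R j) ^- n.
  have /andP[av vb] := abP xi; have v0 := lt_le_trans a0 av.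
  rewrite /shadow_power !lef_pV2 ?posrE ?exprn_gt0 ?divr_gt0//.
  by apply/andP; split; rewrite ler_pXn2r// ?nnegrE ?divr_ge0 ?(ltW v0) ?(ltW om0)
    ?(ltW a0) ?(ltW b0)// ler_pM2r// invr_gt0.
have m : measurable_fun [set: @borel_grassmannian R n j jn] (shadow_power K).
  rewrite (_ : shadow_power K = fun xi : grassmannian jn =>
      (gvol xi (projection K xi) / omega R j) `^ (- n%:R)); last first.
    apply/funext => xi; have /andP[av _] := abP xi; have v0 := lt_le_trans a0 av.
    by rewrite powRN powR_mulrn// divr_ge0// ltW.
  have mg : measurable_fun [set: @borel_grassmannian R n j jn]
      (fun xi : grassmannian jn => gvol xi (projection K xi) / omega R j).
    exact: (measurable_funM (measurable_gvol (jn := jn) cK)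
      (measurable_cst (omega R j)^-1)).
  exact: (measurableT_comp (@measurable_powR R (- n%:R)) mg).
have intK : mu.-integrable setT (EFin \o shadow_power K).
  apply: measurable_bounded_integrable => //.
    by rewrite (le_lt_trans (probability_le1 mu _)) ?ltry.
  exists ((a / omega R j) ^- n); split; first exact: num_real.
  move=> M aM xi _ /=; have /andP[l u] := bounds xi.
  rewrite ger0_norm; first exact: le_trans u (ltW aM).
  by apply: le_trans l; rewrite invr_ge0 exprn_ge0// divr_ge0// ltW.
split => //.
apply: (@lt_le_trans _ _ (\int[mu]_xi (b / omega R j) ^- n)).
  rewrite Rintegral_cst// [X in fine X](probability_setT mu) mulr1 invr_gt0 exprn_gt0//.
  exact: divr_gt0.
apply: le_Rintegral => //.
  by apply: finite_measure_integrable_cst.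
by move=> xi _; case/andP: (bounds xi).
Qed.

Lemma root_invP (I : R) : 0 < I ->
  0 < root_inv I /\ (root_inv I ^+ j) ^+ n = I^-1.
Proof.
move=> I0; have A0 : 0 < root_inv I by rewrite !powR_gt0.
split => //; rewrite -exprM -powR_mulrn ?(ltW A0)//.
rewrite -powR_inv1 ?(ltW I0)// /root_inv -!powRrM; congr (_ `^ _).
by rewrite natrM; field; rewrite !pnatr_eq0 -!lt0n n_ge1 j_ge1.
Qed.

(** The numbers [a], [b], [c] enter through their powers of order jn, the inverse means. The claim
    becomes an upper bound s^(-jn) for the mean belonging to the Minkowski combination, with s = a +
    eps b. *)
Lemma shadow_mean_minkowski K L (eps a b c : R) :
  compact K -> K° 0 -> compact L -> L° 0 -> 0 < eps ->
  0 < a -> (a ^+ j) ^+ n = (shadow_mean K)^-1 ->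
  0 < b -> (b ^+ j) ^+ n = (shadow_mean L)^-1 ->
  0 < c -> (c ^+ j) ^+ n = (shadow_mean (minkowski_comb K eps L))^-1 ->
  a + eps * b <= c.
Proof.
move=> cK K0 cL L0 eps_gt0 a0 aE b0 bE c0 cE.
pose Z := minkowski_comb K eps L.
have cZ : compact Z by exact: compact_minkowski_comb.
have Z0 : Z° 0 by exact: interior_minkowski_comb (interior_subset L0).
have [iK IK0] := shadow_power_integrable cK K0.
have [iL IL0] := shadow_power_integrable cL L0.
have [iZ IZ0] := shadow_power_integrable cZ Z0.
pose s := a + eps * b; pose t := eps * b / s.
have s0 : 0 < s by rewrite addr_gt0// mulr_gt0.
have t1 : 1 - t = a / s.
  have -> : a = s - eps * b by rewrite addrK.
  by rewrite /t; field; rewrite gt_eqF.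
have t01 : 0 < t < 1.
  apply/andP; split; first by rewrite divr_gt0// mulr_gt0.
  by rewrite -subr_gt0 t1 divr_gt0.
have omj0 := omega_gt0 (R := R) (n := j).
(* Divided by their means, the two integrands on the right have integral 1, so the right side
   integrates to s^(-jn). *)
have pointwise xi : shadow_power Z xi <=
    s ^- (j * n) * ((1 - t) * ((shadow_mean K)^-1 * shadow_power K xi) +
                    t * ((shadow_mean L)^-1 * shadow_power L xi)).
  have [aK [_ [aK0 _ /(_ xi)/andP[vK _]]]] := gvol_bounds jn cK K0.
  have [aL [_ [aL0 _ /(_ xi)/andP[vL _]]]] := gvol_bounds jn cL L0.
  have [aZ [_ [aZ0 _ /(_ xi)/andP[vZ _]]]] := gvol_bounds jn cZ Z0.
  have {aK aK0}vK := lt_le_trans aK0 vK; have {aL aL0}vL := lt_le_trans aL0 vL.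
  have {aZ aZ0}vZ := lt_le_trans aZ0 vZ.
  have := lebesgue_rV_shadow_minkowski (frame xi)^T cK cL eps_gt0 a0 b0
    (erefl s) (erefl t).
  rewrite !gvol_projectionE//= lee_fin.
  rewrite /shadow_power -/Z.
  move: vK vL vZ; set vK := gvol xi _; set vL := gvol xi _; set vZ := gvol xi _.
  move=> vK0 vL0 vZ0 BM.
  pose P := vK / a ^+ j; pose Q := vL / b ^+ j.
  have P0 : 0 < P by rewrite divr_gt0// exprn_gt0.
  have Q0 : 0 < Q by rewrite divr_gt0// exprn_gt0.
  have PQ0 : 0 < P `^ (1 - t) * Q `^ t by rewrite mulr_gt0// powR_gt0.
  have BMn : vZ ^- n <= s ^- (j * n) * (P `^ (1 - t) * Q `^ t) ^- n.
    have sPQ0 : 0 < s ^+ j * (P `^ (1 - t) * Q `^ t) by rewrite mulr_gt0// exprn_gt0.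
    rewrite exprM -invfM -exprMn lef_pV2 ?posrE; try exact: exprn_gt0.
    by rewrite ler_pXn2r// ?nnegrE ltW.
  (* The power -n is moved inside the real powers, so the means are compared for P^-n and Q^-n. *)
  have agm : (P `^ (1 - t) * Q `^ t) ^- n <= (1 - t) * P ^- n + t * Q ^- n.
    rewrite exprMn invfM !powR_exprVn ?(ltW P0) ?(ltW Q0)//.
    by apply: weighted_AGM; rewrite ?invr_ge0 ?exprn_ge0 ?(ltW P0) ?(ltW Q0).
  have omE v : (v / omega R j) ^- n = omega R j ^+ n * v ^- n.
    by rewrite expr_div_n invf_div mulrC.
  have PE : P ^- n = (shadow_mean K)^-1 * vK ^- n.
    by rewrite /P expr_div_n invf_div aE mulrC.
  have QE : Q ^- n = (shadow_mean L)^-1 * vL ^- n.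
    by rewrite /Q expr_div_n invf_div bE mulrC.
  rewrite !omE; apply: (@le_trans _ _ (omega R j ^+ n *
      (s ^- (j * n) * ((1 - t) * P ^- n + t * Q ^- n)))).
    rewrite ler_wpM2l ?exprn_ge0 ?(ltW omj0)//; apply: le_trans BMn _.
    by rewrite ler_wpM2l// invr_ge0 exprn_ge0 ?ltW.
  by rewrite PE QE le_eqVlt; apply/orP; left; apply/eqP; ring.
have le_IZ : shadow_mean Z <= s ^- (j * n).
  have mT : measurable [set: @borel_grassmannian R n j jn] by exact: measurableT.
  have iK' := integrableZl mT ((1 - t) * (shadow_mean K)^-1) iK.
  have iL' := integrableZl mT (t * (shadow_mean L)^-1) iL.
  have iS := integrableD mT iK' iL'.
  have iS' := integrableZl mT (s ^- (j * n)) iS.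
  have : shadow_mean Z <= \int[mu]_xi (s ^- (j * n) *
      ((1 - t) * (shadow_mean K)^-1 * shadow_power K xi +
       t * (shadow_mean L)^-1 * shadow_power L xi)).
    apply: le_Rintegral => // xi _; apply: le_trans (pointwise xi) _.
    by rewrite !mulrA.
  rewrite RintegralZl// RintegralD// !RintegralZl//.
  by rewrite -/(shadow_mean K) -/(shadow_mean L) !mulfVK ?gt_eqF// subrK mulr1.
(* Inverting the bound on the mean gives the inequality between powers of order jn; as jn > 0, the
   bases compare in the same way. *)
have : s ^+ (j * n) <= c ^+ (j * n).
  rewrite !exprM cE -exprM -[leLHS]invrK lef_pV2// ?posrE ?invr_gt0 ?exprn_gt0//.
by rewrite ler_pXn2r ?nnegrE ?(ltW s0) ?(ltW c0)// muln_gt0 j_ge1.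
Qed.

End AffineQuermassintegrals.

Theorem theorem2p3 (R : realType) (n j : nat)
    (n_ge1 : (1 <= n)%N) (j_ge1 : (1 <= j)%N) (jn : (j <= n)%N)
    (mu : probability (@borel_grassmannian R n j jn) R) (haar_mu : haar mu)
    (K L : set 'rV[R]_n) (hK : convex_body_o K) (hL : convex_body_o L)
    (eps : R) (eps_gt0 : 0 < eps) :
  affine_quermass mu (minkowski_comb K eps L) `^ j%:R^-1 >=
    affine_quermass mu K `^ j%:R^-1 + eps * affine_quermass mu L `^ j%:R^-1.
Proof.
case: hK hL => -[cK _ _] K0 [[cL _ _] L0].
have cZ := compact_minkowski_comb (eps := eps) cK cL.
have Z0 := interior_minkowski_comb eps K0 (interior_subset L0).
have [_ IK0] := shadow_power_integrable n_ge1 mu cK K0.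
have [_ IL0] := shadow_power_integrable n_ge1 mu cL L0.
have [_ IZ0] := shadow_power_integrable n_ge1 mu cZ Z0.
have [a0 aE] := @root_invP _ _ _ n_ge1 j_ge1 _ IK0.
have [b0 bE] := @root_invP _ _ _ n_ge1 j_ge1 _ IL0.
have [c0 cE] := @root_invP _ _ _ n_ge1 j_ge1 _ IZ0.
(* The common factor [w], the j-th root of the volume of the unit ball, is taken out of all three
   terms. *)
have combine (w x y z a b c : R) : x = w * a -> y = w * b -> z = w * c ->
    0 <= w -> a + eps * b <= c -> x + eps * y <= z.
  by move=> -> -> -> w0 abc; rewrite [eps * _]mulrCA -mulrDr ler_wpM2l.
apply: (combine _ _ _ _ _ _ _ (affine_quermass_root mu K)
  (affine_quermass_root mu L) (affine_quermass_root mu (minkowski_comb K eps L))).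
  exact: powR_ge0.
exact: (shadow_mean_minkowski n_ge1 j_ge1 cK K0 cL L0 eps_gt0 a0 aE b0 bE c0 cE).
Qed.
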